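(* Let $\mathcal U := C_0(\mathbb R,\mathbb R^{n_u})$, and let $U\subset \mathcal U$ and $X\subset\mathbb R^{n_x}$ be convex, closed and bounded sets, with $r=\sup_{\mathbf u\in U}\|\mathbf u\|_{\mathcal U}$. Let $\mathcal P:X\times U\to U$ and $L:X\times U\to\mathbb R$. Suppose that: (1) $\mathcal P$ is differentiable in $x\in X$, and $\mathcal P(x,\mathbf u)$ is a contraction in $\mathbf u$, uniformly in $x\in X$. (2) $\nabla_x\mathcal P(x,\mathbf u)$ is Lipschitz continuous on $(x,\mathbf u)\in X\times U$, and there exist $q<1$, $K>0$, $N\in\mathbb N$ such that for all $n\ge N$, $x_1,x_2\in X$ and $\mathbf u_1,\mathbf u_2\in U$, $$\|\nabla_x\mathcal P^n(x_1,\mathbf u_1)-\nabla_x\mathcal P^n(x_2,\mathbf u_2)\|\le q^n\|\mathbf u_1-\mathbf u_2\|_{\mathcal U}+K\|x_1-x_2\|_X .$$ (3) $L$ has the form $L(x,\mathbf u)=\sum_{i=1}^{N_s}L_i(x,\mathbf u(t_i))$ with $t_i\in\mathbb R$, $L_i\in C^1(X\times B_r)$ and $\nabla L_i$ Lipschitz on $X\times B_r$, where $B_r:=\{u\in\mathbb R^{n_u}:\|u\|\le r\}$. (4) $x\mapsto L(x,\mathcal P^n(x,\mathbf u))$ is strongly convex on $X$, uniformly in $\mathbf u\in U$ and $n\in\mathbb N$. For $\alpha>0$, $\sigma\in(0,1]$, $n\in\mathbb N$, define $\mathcal T$ by $\mathcal T(x,\mathbf u)=(x^+,\mathbf u^+)$,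 where $$x^+=\Pi_X\big[x-\alpha\nabla_xL(x,\mathcal P^n(x,\mathbf u))\big],\qquad \mathbf u^+=(1-\sigma)\mathbf u+\sigma\,\mathcal P(x^+,\mathbf u).$$ Then there exist $\alpha>0$, $\sigma\in(0,1]$ and $n\in\mathbb N$ such that: (a) $\mathcal T$ maps $X\times U$ into $X\times U$ and is a contraction. (b) There exist $\nu<1$ and $(x^*,\mathbf u^* )\in X\times U$ such that for any $(x_0,\mathbf u_0)\in X\times U$, $\lim_{k\to\infty}\mathcal T^k(x_0,\mathbf u_0)=(x^*,\mathbf u^* )$ and $$\|\mathcal T^k(x_0,\mathbf u_0)-(x^*,\mathbf u^* )\|_{X\times\mathcal U}\le\nu^k\big(\|x_0-x^*\|_X+\|\mathbf u_0-\mathbf u^*\|_{\mathcal U}\big).$$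
   Context: $C_0(\mathbb R,\mathbb R^{n_u})$ is the Banach space of continuous functions $\mathbb R\to\mathbb R^{n_u}$ vanishing at infinity, with the sup norm $\|\mathbf u\|_{\mathcal U}=\sup_t\|\mathbf u(t)\|_2$. $\|\cdot\|_X$ is the Euclidean norm, and $\|(x,\mathbf u)\|_{X\times\mathcal U}=\|x\|_X+\|\mathbf u\|_{\mathcal U}$. $\mathcal P^n$ denotes the $n$-fold iterate in the second argument: $\mathcal P^0(x,\mathbf u)=\mathbf u$, $\mathcal P^{n+1}(x,\mathbf u)=\mathcal P(x,\mathcal P^n(x,\mathbf u))$. $\nabla_x\mathcal P^n(x,\mathbf u)$ is the derivative in $x$ of $x\mapsto\mathcal P^n(x,\mathbf u)$, with norm the sup over time of the matrix norm. $\nabla_xL(x,\mathcal P^n(x,\mathbf u))$ denotes the (total) gradient with respect to $x$ of the composite function $x\mapsto L(x,\mathcal P^n(x,\mathbf u))$. $\Pi_X$ is the Euclidean projection onto $X$. A map $\mathcal T:H\to H$ on a metric space is a contraction if there is $q\in[0,1)$ with $\|\mathcal Tu_1-\mathcal Tu_2\|_H\le q\|u_1-u_2\|_H$ for all $u_1,u_2\in H$. A contraction in $\mathbf u$ uniformly in $x$ means that the same $q$ works for all $x\in X$. A function is strongly convex on $X$ with modulus $\mu>0$ if $F(x)-\frac{\mu}{2}\|x\|^2$ is convex on $X$; strong convexity uniformly in $\mathbf u$ and $n$ means that one $\mu>0$ works for all $\mathbf u\in U$, $n\in\mathbb N$. *)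

(* Defs.v *)
From HB Require Import structures.
From mathcomp Require Import all_boot all_order all_algebra ring lra.
From mathcomp Require Import all_classical all_reals all_analysis.

Set Implicit Arguments.
Unset Strict Implicit.
Unset Printing Implicit Defensive.

Import Order.TTheory GRing.Theory Num.Theory.
Import numFieldNormedType.Exports.

Local Open Scope classical_set_scope.
Local Open Scope ring_scope.

(* Vectors of R^n are rows. The library's norm `|x| on 'rV[R]_n is the maximum
   norm; it induces the same topology and bounded sets as [enorm]. *)
Section Euclidean.
Context {R : realType} {n : nat}.
Implicit Types x y : 'rV[R]_n.

Definition dot x y : R := \sum_(i < n) x ord0 i * y ord0 i.

Definition enorm x : R := Num.sqrt (dot x x).

Lemma dotC x y : dot x y = dot y x.
Proof. by apply: eq_bigr => i _; rewrite mulrC. Qed.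

Lemma dotDl x y z : dot (x + y) z = dot x z + dot y z.
Proof. by rewrite -big_split; apply: eq_bigr => i _; rewrite mxE mulrDl. Qed.

Lemma dotZl a x y : dot (a *: x) y = a * dot x y.
Proof. by rewrite mulr_sumr; apply: eq_bigr => i _; rewrite mxE mulrA. Qed.

Lemma dot_ge0 x : 0 <= dot x x.
Proof. by apply: sumr_ge0 => i _; rewrite -expr2 sqr_ge0. Qed.

Lemma enorm_ge0 x : 0 <= enorm x.
Proof. exact: sqrtr_ge0. Qed.

Lemma enorm_sqr x : enorm x ^+ 2 = dot x x.
Proof. by rewrite sqr_sqrtr// dot_ge0. Qed.

Lemma enormZ a x : enorm (a *: x) = `|a| * enorm x.
Proof.
rewrite /enorm dotZl dotC dotZl mulrA -expr2.
by rewrite sqrtrM ?sqr_ge0// sqrtr_sqr.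
Qed.

Lemma coord_le_enorm x i : `|x ord0 i| <= enorm x.
Proof.
rewrite -sqrtr_sqr ler_wsqrtr// /dot (bigD1 i)//= -expr2 lerDl.
by apply: sumr_ge0 => j _; rewrite -expr2 sqr_ge0.
Qed.

Lemma enorm_eq0 x : enorm x = 0 -> x = 0.
Proof.
move=> x0; apply/rowP => i; rewrite mxE; apply/eqP.
by rewrite -normr_le0 -x0; exact: coord_le_enorm.
Qed.

Lemma dot_le_enorm x y : dot x y <= enorm x * enorm y.
Proof.
have [/enorm_eq0 ->|x0] := eqVneq (enorm x) 0.
  rewrite -(scale0r 0) dotZl mul0r.
  by rewrite mulr_ge0// enorm_ge0.
have [/enorm_eq0 ->|y0] := eqVneq (enorm y) 0.
  rewrite dotC -(scale0r 0) dotZl mul0r.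
  by rewrite mulr_ge0// enorm_ge0.
have xy0 : 0 < enorm x * enorm y.
  by rewrite mulr_gt0// lt_neqAle eq_sym ?x0 ?y0 enorm_ge0.
have := dot_ge0 (enorm y *: x + (- enorm x) *: y).
rewrite !(dotDl, dotZl) !(dotC _ (_ + _)) !(dotDl, dotZl) (dotC y x).
rewrite -!enorm_sqr; set a := enorm x; set b := enorm y; set d := dot x y.
have -> : b * (b * a ^+ 2 + - a * d) + - a * (b * d + - a * b ^+ 2) =
  2 * (a * b) * (a * b - d).
  by ring.
by rewrite pmulr_rge0 ?subr_ge0// mulr_gt0.
Qed.

Lemma enormD x y : enorm (x + y) <= enorm x + enorm y.
Proof.
rewrite -(@ler_pXn2r _ 2) ?nnegrE ?enorm_ge0 ?addr_ge0 ?enorm_ge0//.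
rewrite enorm_sqr dotDl !(dotC _ (_ + _)) !dotDl (dotC y x) sqrrD !enorm_sqr.
by have := dot_le_enorm x y; lra.
Qed.

End Euclidean.

Lemma enorm_le_norm {R : realType} n (x : 'rV[R]_n) :
  enorm x <= Num.sqrt n%:R * `|x|.
Proof.
rewrite -[`|x|]ger0_norm// -sqrtr_sqr -sqrtrM// ler_wsqrtr//.
rewrite /dot mulrC -[n in n%:R]card_ord -sumr_const mulr_sumr.
apply: ler_sum => i _; rewrite mulr1 -expr2 -real_normK ?num_real// lerXn2r ?nnegrE//.
rewrite [leRHS]/Num.norm /= mx_normrE; apply/bigmax_geP; right => /=.
by exists (ord0, i).
Qed.

Definition is_C0 {R : realType} {n : nat} : {pred R -> 'rV[R]_n} :=
  mem [set f : R -> 'rV[R]_n |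
    [/\ continuous f, f @ +oo --> (0 : 'rV[R]_n) & f @ -oo --> (0 : 'rV[R]_n)]].

Record C0 (R : realType) (n : nat) := MkC0 {
  C0_val :> R -> 'rV[R]_n;
  C0_valP : C0_val \in is_C0 }.

Section C0_space.
Context {R : realType} {n : nat}.

HB.instance Definition _ := [isSub of C0 R n for @C0_val R n].
HB.instance Definition _ := [Choice of C0 R n by <:].

Lemma is_C0_submod_closed : submod_closed (@is_C0 R n).
Proof.
split=> [|a f g /set_mem[cf pf nf] /set_mem[cg pg ng]]; apply/mem_set.
  by split; [exact: cst_continuous|exact: cvg_cst|exact: cvg_cst].
split.
- by move=> t; apply: cvgD; [apply: cvgZr; exact: cf|exact: cg].
- rewrite -[0](addr0 (0 : 'rV[R]_n)) -[X in X + 0](scaler0 _ a).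
  by apply: cvgD => //; exact: cvgZr.
- rewrite -[0](addr0 (0 : 'rV[R]_n)) -[X in X + 0](scaler0 _ a).
  by apply: cvgD => //; exact: cvgZr.
Qed.

HB.instance Definition _ :=
  GRing.isSubmodClosed.Build _ _ (@is_C0 R n) is_C0_submod_closed.
HB.instance Definition _ := [SubChoice_isSubLmodule of C0 R n by <:].

Definition C0_norm (f : C0 R n) : R := sup (range (fun t => enorm (f t))).

Lemma C0_has_sup (f : C0 R n) : has_sup (range (fun t => enorm (f t))).
Proof.
split; first by exists (enorm (f 0)), 0.
have [cf /cvgrPdist_lt/(_ _ ltr01) pf /cvgrPdist_lt/(_ _ ltr01) nf] :=
  set_mem (C0_valP f).
have [a _ fa] : exists2 a, True & forall t, a < t -> `|f t| < 1.
  by case: pf => a [_ fa]; exists a => // t /fa; rewrite /= sub0r normrN.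
have [b _ fb] : exists2 b, True & forall t, t < b -> `|f t| < 1.
  by case: nf => b [_ fb]; exists b => // t /fb; rewrite /= sub0r normrN.
have : compact (f @` `[b, a]).
  apply: continuous_compact; last exact: segment_compact.
  exact: continuous_subspaceT.
move=> /compact_bounded[M [_ /(_ (Num.max M 1 + 1))]].
have MM1 : M < Num.max M 1 + 1 by rewrite ltr_pwDr// le_max lexx.
move=> /(_ MM1) fM.
exists (Num.sqrt n%:R * (Num.max M 1 + 1)) => _ [t _ <-].
apply: (le_trans (enorm_le_norm _)); rewrite ler_wpM2l//.
have le1 : 1 <= Num.max M 1 + 1 :> R.
  by rewrite (@le_trans _ _ (Num.max M 1)) ?le_max ?lexx ?orbT// lerDl.
have [/fa/ltW ft|ta] := ltP a t; first exact: le_trans ft le1.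
have [/fb/ltW ft|tb] := ltP t b; first exact: le_trans ft le1.
by apply: fM; exists t => //=; rewrite in_itv/= tb ta.
Qed.

Lemma enorm_le_C0_norm (f : C0 R n) t : enorm (f t) <= C0_norm f.
Proof. by apply: ub_le_sup; [case: (C0_has_sup f)|exists t]. Qed.

Lemma C0_norm_le (f : C0 R n) M : (forall t, enorm (f t) <= M) -> C0_norm f <= M.
Proof.
by move=> fM; apply: ge_sup; [case: (C0_has_sup f)|move=> _ [t _ <-]].
Qed.

Lemma C0_normD (f g : C0 R n) : C0_norm (f + g) <= C0_norm f + C0_norm g.
Proof.
apply: C0_norm_le => t; apply: (le_trans (enormD _ _)).
by rewrite lerD// enorm_le_C0_norm.
Qed.

Lemma C0_norm_ge0 (f : C0 R n) : 0 <= C0_norm f.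
Proof. exact: le_trans (enorm_ge0 (f 0)) (enorm_le_C0_norm f 0). Qed.

Lemma C0_norm_eq0 (f : C0 R n) : C0_norm f = 0 -> f = 0.
Proof.
move=> f0; apply/val_inj/funext => t /=; apply: enorm_eq0.
by apply/eqP; rewrite eq_le enorm_ge0 andbT -f0; exact: enorm_le_C0_norm.
Qed.

Lemma C0_normZ a (f : C0 R n) : C0_norm (a *: f) = `|a| * C0_norm f.
Proof.
have le_normZ b (g : C0 R n) : C0_norm (b *: g) <= `|b| * C0_norm g.
  apply: C0_norm_le => t; rewrite [leLHS](enormZ b (g t)).
  by rewrite ler_wpM2l// enorm_le_C0_norm.
apply/eqP; rewrite eq_le le_normZ/=.
have [->|a0] := eqVneq a 0; first by rewrite normr0 mul0r C0_norm_ge0.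
rewrite -ler_pdivlMl ?normr_gt0// -normfV.
by rewrite -[X in C0_norm X <= _](scalerK a0); exact: le_normZ.
Qed.

HB.instance Definition _ :=
  Lmodule_isNormed.Build R (C0 R n) C0_normD C0_normZ C0_norm_eq0.

Lemma C0_normE (f : C0 R n) : `|f| = sup (range (fun t => enorm (f t))).
Proof. by []. Qed.

End C0_space.

Section Differentiation.
Context {R : realType}.

(* [df] is a Frechet derivative at [x] of the restriction of [f] to [D]. It is
   unique when [D] is convex with nonempty interior; in general it is determined
   in the directions of the affine hull of [D] only. *)
Definition is_diff_within (V W : normedModType R) (D : set V)
    (f df : V -> W) (x : V) :=
  [/\ linear df, continuous df &
    (fun y => `|y - x|^-1 *: (f y - f x - df (y - x))) @ within D x^'
      --> (0 : W)].

Definition is_grad_within (n : nat) (D : set 'rV[R]_n) (f : 'rV[R]_n -> R)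
    (x g : 'rV[R]_n) :=
  is_diff_within D (f : _ -> R^o) (dot g) x.

Definition is_grad_within2 (n m : nat) (D : set ('rV[R]_n * 'rV[R]_m))
    (f : 'rV[R]_n * 'rV[R]_m -> R) (z g : 'rV[R]_n * 'rV[R]_m) :=
  is_diff_within D (f : _ -> R^o) (fun h => dot g.1 h.1 + dot g.2 h.2) z.

(* Where the gradient is not unique, an arbitrary one is chosen. *)
Definition grad_within (n : nat) (D : set 'rV[R]_n) (f : 'rV[R]_n -> R)
    (x : 'rV[R]_n) : 'rV[R]_n :=
  get [set g | is_grad_within D f x g].

(* Matrix norm induced by the Euclidean norm; matrices act on rows. *)
Definition opnorm (m n : nat) (M : 'M[R]_(m, n)) : R :=
  sup [set enorm (h *m M) | h in [set h : 'rV[R]_m | enorm h <= 1]].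

(* Supremum over time of the norm of the matrix of [h |-> A h t]. *)
Definition diff_norm (m n : nat) (A : 'rV[R]_m -> C0 R n) : R :=
  sup (range (fun t => opnorm (lin1_mx (fun h => A h t)))).

End Differentiation.

Section Optimization.
Context {R : realType}.

Definition contraction_with (T : Type) (dist : T -> T -> R) (q : R)
    (H : set T) (f : T -> T) :=
  [/\ 0 <= q, q < 1 &
    forall a b, H a -> H b -> dist (f a) (f b) <= q * dist a b].

Definition strongly_convex (n : nat) (X : set 'rV[R]_n) (mu : R)
    (F : 'rV[R]_n -> R) :=
  0 < mu /\ convex_function X (fun x => F x - mu / 2 * enorm x ^+ 2).

Definition euclidean_proj (n : nat) (X : set 'rV[R]_n) (y : 'rV[R]_n) :
    'rV[R]_n :=
  get [set p | X p /\ forall z, X z -> enorm (y - p) <= enorm (y - z)].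

Definition euclidean_ball (n : nat) (r : R) : set 'rV[R]_n :=
  [set v | enorm v <= r].

End Optimization.

Section Algorithm.
Context {R : realType} {nx nu : nat}.
Implicit Types (P : 'rV[R]_nx -> C0 R nu -> C0 R nu)
  (L : 'rV[R]_nx -> C0 R nu -> R).

Definition sum_norm (z : 'rV[R]_nx * C0 R nu) : R := enorm z.1 + `|z.2|.

Definition iterP P (n : nat) (x : 'rV[R]_nx) (u : C0 R nu) : C0 R nu :=
  iter n (P x) u.

(* [x |-> L(x, P^n(x, u))] *)
Definition reducedL P L (n : nat) (u : C0 R nu) (x : 'rV[R]_nx) : R :=
  L x (iterP P n x u).

(* The step does not depend on the choice made in [grad_within]: two gradients
   within [X] differ by a vector orthogonal to the affine hull of [X], which the
   projection onto [X] ignores. *)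
Definition stepT P L (X : set 'rV[R]_nx) (alpha sigma : R) (n : nat)
    (z : 'rV[R]_nx * C0 R nu) : 'rV[R]_nx * C0 R nu :=
  let xp :=
    euclidean_proj X (z.1 - alpha *: grad_within X (reducedL P L n z.2) z.1) in
  (xp, (1 - sigma) *: z.2 + sigma *: P xp z.2).

End Algorithm.

(* Main.v *)
From HB Require Import structures.
Require Import Defs.
From mathcomp Require Import all_boot all_order all_algebra ring lra.
From mathcomp Require Import all_classical all_reals all_analysis.
Import Order.TTheory GRing.Theory Num.Theory.
Import numFieldNormedType.Exports.
Local Open Scope classical_set_scope.
Local Open Scope ring_scope.

(** The step couples a projected gradient step in [x] with a relaxation in [u],
    and it contracts because the coupling from [u] to [x] can be made as weak as
    desired by iterating the inner contraction often enough.

    Write dx and du for the distances between two arguments. Strong convexity and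
    a Lipschitz gradient make the projected gradient step contract in [x] by a
    factor [1 - alpha * mu / 2] for small [alpha]; since the gradient also depends
    on [u], the new distance in [x] is at most
    [(1 - alpha * mu / 2) * dx + alpha * c_n * du], where c_n is a Lipschitz
    constant in [u] of the gradient of the reduced loss with [n] inner iterations
    ([projected_gradient_step_le], [stepT_x_le]). The relaxation contracts in [u]
    by [1 - sigma * (1 - q)], up to the term [sigma * M] times the new distance in
    [x], [M] being a Lipschitz constant of [P] in [x] ([relaxation_le]). In the sum
    norm it suffices that [alpha] be small against the constants of the loss, then
    [sigma] against [alpha], and finally c_n against both
    ([stepT_contraction], [step_parameters]).

    This order of choices is possible because the Lipschitz constant in [x] of the
    gradient is uniform in [n] and c_n tends to [0]
    ([reducedL_grad_lipschitz]). By the chain rule the gradient is a sum of terms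
    in which the gradients of the [Li] at the iterate are combined with the
    derivative of the iterate. The iterates are Lipschitz in [x] with the uniform
    constant [M / (1 - q)] and in [u] with [q ^+ n] ([iterP_lipschitz]), and the
    derivative of the iterate varies with [u] by a geometrically small amount by
    hypothesis. A negative rate in that hypothesis forces [U] to be a point
    ([gradPn_bound_nonneg]).

    As [X] may have empty interior, its points see a derivative only in the
    directions [a - b] with [a] and [b] in [X]. All estimates of gradients are
    therefore tested against such directions only; these directions suffice for
    the projection, by its firm nonexpansiveness ([euclidean_proj_firm]), and they
    are closed under linear combinations up to scaling ([convex_dir_comb]).

    The limit and the rate then come from Banach's theorem on the closed set
    [X `*` U], the space of signals being complete ([C0_complete],
    [contraction_fixpoint]). *)

Set Implicit Arguments.
Unset Strict Implicit.
Unset Printing Implicit Defensive.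

(** * Euclidean geometry and operator norms *)

Section EuclideanSpace.
Context {R : realType} {n : nat}.
Implicit Types x y z : 'rV[R]_n.

Lemma dotDr x y z : dot x (y + z) = dot x y + dot x z.
Proof. by rewrite dotC dotDl !(dotC x). Qed.

Lemma dotZr a x y : dot x (a *: y) = a * dot x y.
Proof. by rewrite dotC dotZl dotC. Qed.

Lemma dotNl x y : dot (- x) y = - dot x y.
Proof. by rewrite -scaleN1r dotZl mulN1r. Qed.

Lemma dotNr x y : dot x (- y) = - dot x y.
Proof. by rewrite dotC dotNl dotC. Qed.

Lemma dotBl x y z : dot (x - y) z = dot x z - dot y z.
Proof. by rewrite dotDl dotNl. Qed.

Lemma dotBr x y z : dot x (y - z) = dot x y - dot x z.
Proof. by rewrite dotDr dotNr. Qed.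

Definition dotE := (@dotDl R n, dotDr, dotBl, dotBr, @dotZl R n, dotZr, dotNl, dotNr).

Lemma dot0r x : dot x 0 = 0.
Proof. by rewrite -(scale0r 0) dotZr mul0r. Qed.

Lemma enorm0 : enorm (0 : 'rV[R]_n) = 0.
Proof. by rewrite /enorm dot0r sqrtr0. Qed.

Lemma enormN x : enorm (- x) = enorm x.
Proof. by rewrite -scaleN1r enormZ normrN1 mul1r. Qed.

Lemma enormBC x y : enorm (x - y) = enorm (y - x).
Proof. by rewrite -enormN opprB. Qed.

Lemma enorm_dist_le x y z : enorm (x - z) <= enorm (x - y) + enorm (y - z).
Proof. by apply: le_trans (enormD _ _); rewrite addrA subrK. Qed.

Lemma norm_dot_le x y : `|dot x y| <= enorm x * enorm y.
Proof.
by rewrite ler_norml lerNl -dotNl -(enormN x) dot_le_enorm enormN dot_le_enorm.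
Qed.

Lemma norm_le_enorm x : `|x| <= enorm x.
Proof.
rewrite [leLHS]/Num.norm /= mx_normrE; apply/bigmax_leP; split => [|[i j] _ /=].
  exact: enorm_ge0.
by rewrite (ord1 i) coord_le_enorm.
Qed.

End EuclideanSpace.

(** The images of the finitely many basis vectors control a linear map, so its
    operator norm is finite whatever the seminorm [N] of the target: this gives
    the suprema [opnorm] and [diff_norm] their meaning, for which the target is
    normed by [enorm] and by the sup norm respectively. *)
Lemma linear_seminorm_le {R : realType} n (W : lmodType R) (N : W -> R)
    (f : 'rV[R]_n -> W) :
  linear f -> (forall v w, N (v + w) <= N v + N w) ->
  (forall a v, N (a *: v) = `|a| * N v) ->
  forall h, N (f h) <= (\sum_(i < n) N (f 'e_i)) * enorm h.
Proof.
move=> lf ND NZ h.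
pose fL := GRing.isLinear.Build _ _ _ _ f lf.
pose F : {linear 'rV[R]_n -> W} := HB.pack f fL.
have N0 : N 0 = 0 by rewrite -(scale0r 0) NZ normr0 mul0r.
have Nge0 v : 0 <= N v.
  have := ND v (- v); rewrite subrr N0 -scaleN1r NZ normrN1 mul1r.
  by lra.
have -> : f h = F (\sum_(i < n) h 0 i *: 'e_i) by rewrite -row_sum_delta.
rewrite raddf_sum mulr_suml.
apply: (@le_trans _ _ (\sum_(i < n) N (F (h 0 i *: 'e_i)))).
  by elim/big_ind2 : _ => [|v a w b vx wy|//]; rewrite ?N0// (le_trans (ND _ _))// lerD.
apply: ler_sum => i _; rewrite linearZ NZ mulrC ler_wpM2l ?Nge0//.
exact: coord_le_enorm.
Qed.

Section OperatorNorm.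
Context {R : realType}.

Lemma opnorm_has_sup m n (M : 'M[R]_(m, n)) :
  has_sup [set enorm (h *m M) | h in [set h : 'rV[R]_m | enorm h <= 1]].
Proof.
split; first by exists (enorm (0 *m M)), 0 => //=; rewrite enorm0.
have lM : linear (fun h : 'rV_m => h *m M) by move=> a u v; rewrite mulmxDl scalemxAl.
have := linear_seminorm_le lM (@enormD _ _) (@enormZ _ _).
set C := \sum_(i < m) _ => hC; exists C => _ [h /= h1 <-].
rewrite (le_trans (hC h))// ler_piMr// /C; apply: sumr_ge0 => i _.
exact: enorm_ge0.
Qed.

Lemma enorm_mulmx_le m n (M : 'M[R]_(m, n)) h :
  enorm (h *m M) <= opnorm M * enorm h.
Proof.
have [/enorm_eq0 ->|h0] := eqVneq (enorm h) 0; first by rewrite mul0mx !enorm0 mulr0.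
have h_gt0 : 0 < enorm h by rewrite lt_def h0 enorm_ge0.
rewrite -ler_pdivrMr// mulrC -[X in X * _]gtr0_norm ?invr_gt0// -enormZ scalemxAl.
apply: ub_le_sup; first by case: (opnorm_has_sup M).
by exists ((enorm h)^-1 *: h) => //=; rewrite enormZ normfV gtr0_norm// mulVf.
Qed.

Lemma opnorm_le m n (M : 'M[R]_(m, n)) C : 0 <= C ->
  (forall h, enorm (h *m M) <= C * enorm h) -> opnorm M <= C.
Proof.
move=> C0 hC; apply: ge_sup; first by case: (opnorm_has_sup M).
by move=> _ [h /= h1 <-]; rewrite (le_trans (hC h))// ler_piMr.
Qed.

Lemma opnorm_ge0 m n (M : 'M[R]_(m, n)) : 0 <= opnorm M.
Proof.
apply: ub_le_sup; first by case: (opnorm_has_sup M).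
by exists 0; rewrite /= ?mul0mx ?enorm0.
Qed.

Section DiffNorm.
Variables (m n : nat) (A : 'rV[R]_m -> C0 R n).
Hypothesis lA : linear A.

Lemma enorm_diff_le h t :
  enorm (A h t) <= opnorm (lin1_mx (fun h => A h t)) * enorm h.
Proof.
have lAt : linear (fun h => A h t) by move=> a u v; rewrite lA.
pose F : {linear 'rV[R]_m -> 'rV[R]_n} :=
  HB.pack (fun h => A h t) (GRing.isLinear.Build _ _ _ _ _ lAt).
have -> : A h t = h *m lin1_mx F by rewrite mul_rV_lin1.
exact: enorm_mulmx_le.
Qed.

Lemma diff_norm_has_sup :
  has_sup (range (fun t => opnorm (lin1_mx (fun h => A h t)))).
Proof.
split; first by exists (opnorm (lin1_mx (fun h => A h 0))), 0.
have := linear_seminorm_le lA (@ler_normD _ _) (fun a v => normrZ a v).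
set C := \sum_(i < m) _ => hC; exists C => _ [t _ <-].
have C0 : 0 <= C by apply: sumr_ge0.
apply: opnorm_le => // h.
have lAt : linear (fun h => A h t) by move=> a u v; rewrite lA.
pose F : {linear 'rV[R]_m -> 'rV[R]_n} :=
  HB.pack (fun h => A h t) (GRing.isLinear.Build _ _ _ _ _ lAt).
have -> : h *m lin1_mx (fun h => A h t) = A h t by rewrite (mul_rV_lin1 F).
by rewrite (le_trans (enorm_le_C0_norm _ _) (hC h)).
Qed.

Lemma diff_norm_ge0 : 0 <= diff_norm A.
Proof.
apply: le_trans (opnorm_ge0 (lin1_mx (fun h => A h 0))) _.
by apply: ub_le_sup; [case: diff_norm_has_sup|exists 0].
Qed.

(** [diff_norm] exchanges the order of two suprema, over time and over the
    directions [h]; a bound on it is thus a bound in the sup norm for every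
    direction. *)
Lemma norm_diff_le h : `|A h| <= diff_norm A * enorm h.
Proof.
apply: C0_norm_le => t; apply: (le_trans (enorm_diff_le h t)).
rewrite ler_wpM2r ?enorm_ge0//.
by apply: ub_le_sup; [case: diff_norm_has_sup|exists t].
Qed.

End DiffNorm.

End OperatorNorm.

Lemma linearBf {R : pzRingType} (V W : lmodType R) (f g : V -> W) :
  linear f -> linear g -> linear (fun h => f h - g h).
Proof. by move=> lf lg a u v; rewrite lf lg scalerBr opprD addrACA. Qed.

(** * Derivatives within a set *)

Section DiffWithin.
Context {R : realType}.
Implicit Types V W Z : normedModType R.

Lemma linear_fun0 (V W : lmodType R) (f : V -> W) : linear f -> f 0 = 0.
Proof. by move=> lf; have := lf (-1) 0 0; rewrite scaler0 addr0 scaleN1r addNr. Qed.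

Lemma linear_funZ (V W : lmodType R) (f : V -> W) a v :
  linear f -> f (a *: v) = a *: f v.
Proof. by move=> lf; have := lf a v 0; rewrite (linear_fun0 lf) !addr0. Qed.

Lemma linear_funD (V W : lmodType R) (f : V -> W) v w :
  linear f -> f (v + w) = f v + f w.
Proof. by move=> lf; have := lf 1 v w; rewrite !scale1r. Qed.

Lemma linear_funB (V W : lmodType R) (f : V -> W) v w :
  linear f -> f (v - w) = f v - f w.
Proof. by move=> lf; rewrite -scaleN1r linear_funD// linear_funZ// scaleN1r. Qed.

(** The quotient in the definition is undefined at [x] itself; multiplying by
    [`|y - x|] gives an estimate that also covers [y = x] and can be summed,
    composed and restricted. *)
Lemma is_diff_withinP V W (D : set V) (f df : V -> W) x :
  is_diff_within D f df x <->
  [/\ linear df, continuous df & forall e, 0 < e -> exists2 d, 0 < d &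
    forall y, D y -> `|y - x| < d ->
      `|f y - f x - df (y - x)| <= e * `|y - x|].
Proof.
split=> -[ldf cdf fdf]; split => //.
- move=> e e0; have /cvgrPdist_le /(_ e e0) := fdf.
  rewrite near_withinE /dnbhs near_withinE => /nbhs_ballP[d /= d0 fd].
  exists d => // y Dy yxd; have [->|yx] := eqVneq y x.
    by rewrite !subrr (linear_fun0 ldf) subrr !normr0 mulr0.
  have xyd : ball x d y by rewrite -ball_normE /= distrC.
  have := fd _ xyd yx Dy; rewrite sub0r normrN normrZ normfV normr_id.
  by rewrite ler_pdivrMl ?normr_gt0 ?subr_eq0// mulrC.
- apply/cvgrPdist_le => e e0; have [d d0 fd] := fdf e e0.
  rewrite near_withinE /dnbhs near_withinE; apply/nbhs_ballP; exists d => //= y.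
  rewrite -ball_normE /= distrC => xyd yx Dy.
  rewrite sub0r normrN normrZ normfV normr_id.
  by rewrite ler_pdivrMl ?normr_gt0 ?subr_eq0// mulrC; exact: fd.
Qed.

Lemma continuous_linear_bound V W (df : V -> W) :
  linear df -> continuous df -> exists2 C, 0 < C & forall v, `|df v| <= C * `|v|.
Proof.
move=> ldf cdf.
pose F : {linear V -> W} := HB.pack df (GRing.isLinear.Build _ _ _ _ _ ldf).
have /linear_bounded_continuous/linear_boundedP [M [_ FM]] : continuous F by [].
exists (Num.max M 0 + 1); first by rewrite ltr_pwDr// le_max lexx orbT.
by apply: FM; rewrite ltr_pwDr// le_max lexx.
Qed.

Lemma bounded_linear_continuous V W (df : V -> W) C :
  linear df -> (forall v, `|df v| <= C * `|v|) -> continuous df.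
Proof.
move=> ldf dfC.
pose F : {linear V -> W} := HB.pack df (GRing.isLinear.Build _ _ _ _ _ ldf).
suff : continuous F by [].
apply/linear_bounded_continuous/linear_boundedP.
exists C; split; first exact: num_real.
by move=> r Cr x /=; rewrite (le_trans (dfC x))// ler_wpM2r// ltW.
Qed.

Lemma is_diff_within_lipschitz V W (D : set V) (f df : V -> W) x :
  is_diff_within D f df x -> exists C d, [/\ 0 < C, 0 < d &
    forall y, D y -> `|y - x| < d -> `|f y - f x| <= C * `|y - x|].
Proof.
move=> /is_diff_withinP[ldf cdf /(_ 1 ltr01)[d d0 fd]].
have [C C0 dfC] := continuous_linear_bound ldf cdf.
exists (1 + C), d; split=> // [|y Dy yxd]; first by rewrite addr_gt0.
rewrite -(subrK (df (y - x)) (f y - f x)) (le_trans (ler_normD _ _))// mulrDl.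
by rewrite lerD ?fd.
Qed.

(** The chain rule holds up to the boundary because [f] maps [D], where the limit
    is taken, into [E], where the expansion of [g] holds. *)
Lemma is_diff_within_comp V W Z (D : set V) (E : set W) (f df : V -> W)
    (g dg : W -> Z) x :
  (forall y, D y -> E (f y)) ->
  is_diff_within D f df x -> is_diff_within E g dg (f x) ->
  is_diff_within D (fun y => g (f y)) (fun h => dg (df h)) x.
Proof.
move=> fDE fx gx; have [C [d [C0 d0 fC]]] := is_diff_within_lipschitz fx.
move/is_diff_withinP: fx => [ldf cdf fx]; move/is_diff_withinP: gx => [ldg cdg gx].
have [B B0 dgB] := continuous_linear_bound ldg cdg.
apply/is_diff_withinP; split=> [a u v|u|e e0].
- by rewrite ldf ldg.
- by apply: continuous_comp; [exact: cdf|exact: cdg].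
have [d1 d10 fd1] := fx (e / (2 * B)) (divr_gt0 e0 (mulr_gt0 (ltr0n _ 2) B0)).
have [d2 d20 gd2] := gx (e / (2 * C)) (divr_gt0 e0 (mulr_gt0 (ltr0n _ 2) C0)).
exists (Num.min d (Num.min d1 (d2 / C))).
  by rewrite !lt_min d0 d10 divr_gt0.
move=> y Dy; rewrite !lt_min => /and3P[yd yd1 yd2].
have -> : g (f y) - g (f x) - dg (df (y - x)) =
    (g (f y) - g (f x) - dg (f y - f x)) + dg (f y - f x - df (y - x)).
  by rewrite [dg (_ - _ - _)]linear_funB// addrA subrK.
rewrite (le_trans (ler_normD _ _))//.
rewrite (_ : e * _ = e / (2 * C) * (C * `|y - x|) + B * (e / (2 * B) * `|y - x|)); last first.
  by field; rewrite ?gt_eqF.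
apply: lerD.
- have fyC := fC y Dy yd.
  apply: le_trans (gd2 _ (fDE _ Dy) _) _.
    by rewrite (le_lt_trans fyC)// mulrC -ltr_pdivlMr.
  by rewrite ler_wpM2l// divr_ge0 ?mulr_ge0// ltW.
- by rewrite (le_trans (dgB _))// ler_wpM2l ?(ltW B0)// fd1.
Qed.

Lemma is_diff_within_linear V W (D : set V) (f : V -> W) x :
  linear f -> continuous f -> is_diff_within D f f x.
Proof.
move=> lf cf; apply/is_diff_withinP; split=> // e e0; exists 1 => // y _ _.
by rewrite -linear_funB// subrr normr0 mulr_ge0// ltW.
Qed.

Lemma is_diff_within_pair V W Z (D : set V) (f df : V -> W) (g dg : V -> Z) x :
  is_diff_within D f df x -> is_diff_within D g dg x ->
  is_diff_within D (fun y => (f y, g y)) (fun h => (df h, dg h)) x.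
Proof.
move=> /is_diff_withinP[ldf cdf fx] /is_diff_withinP[ldg cdg gx].
apply/is_diff_withinP; split=> [a u v|u|e e0].
- by rewrite ldf ldg.
- by apply: cvg_pair; [exact: cdf|exact: cdg].
have [d1 d10 fd1] := fx e e0; have [d2 d20 gd2] := gx e e0.
exists (Num.min d1 d2); first by rewrite lt_min d10.
move=> y Dy; rewrite lt_min => /andP[yd1 yd2].
by rewrite prod_normE ge_max /= fd1// gd2.
Qed.

Lemma is_diff_within_sum V W (D : set V) (I : finType) (f df : I -> V -> W) x :
  (forall i, is_diff_within D (f i) (df i) x) ->
  is_diff_within D (fun y => \sum_i f i y) (fun h => \sum_i df i h) x.
Proof.
move=> fx; have {}fx i := (is_diff_withinP _ _ _ _).1 (fx i).
apply/is_diff_withinP; split=> [a u v|u|e e0].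
- rewrite scaler_sumr -big_split; apply: eq_bigr => i _.
  by have [ldf _ _] := fx i; rewrite ldf.
- apply: (@continuous_big _ _ +%R 0 xpredT add_continuous) => i _.
  have [_ cdf _] := fx i; exact: cdf.
have e0' : 0 < e / #|I|.+1%:R by rewrite divr_gt0.
have /choice[d dP] i : exists d, 0 < d /\ forall y, D y -> `|y - x| < d ->
    `|f i y - f i x - df i (y - x)| <= e / #|I|.+1%:R * `|y - x|.
  by have [_ _ /(_ _ e0')[d d0 fd]] := fx i; exists d.
exists (\big[Num.min/1]_i d i).
  by elim/big_ind : _ => // [a b a0 b0|i _]; [rewrite lt_min a0|case: (dP i)].
move=> y Dy yd; rewrite -!sumrB (le_trans (ler_norm_sum _ _ _))//.
apply: (@le_trans _ _ (\sum_(i : I) e / #|I|.+1%:R * `|y - x|)).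
  apply: ler_sum => i _; have [_ ->//] := dP i.
  by rewrite (lt_le_trans yd)// bigmin_le_cond.
rewrite sumr_const -mulrnAl ler_wpM2r// -mulr_natr -mulrA ler_piMr ?ltW//.
by rewrite mulrC ltr_pdivrMr// mul1r ltr_nat.
Qed.

Lemma eq_is_diff_within V W (D : set V) (f g df : V -> W) x :
  D x -> (forall y, D y -> f y = g y) ->
  is_diff_within D f df x -> is_diff_within D g df x.
Proof.
move=> Dx fg /is_diff_withinP[ldf cdf fx]; apply/is_diff_withinP; split=> // e e0.
have [d d0 fd] := fx e e0; exists d => // y Dy yd.
by rewrite -(fg y)// -(fg x)//; exact: fd.
Qed.

End DiffWithin.

(** * Mean value inequality and directional derivatives on convex sets *)

Section Convexity.
Context {R : realType}.

Lemma convex_set_conv (V : lmodType R) (X : set V) x y s :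
  convex_set X -> X x -> X y -> 0 <= s <= 1 -> X (s *: x + (1 - s) *: y).
Proof.
move=> cX Xx Xy /andP[s0 s1].
have := cX x y (Itv01 s0 s1); rewrite !inE => /(_ Xx Xy).
by [].
Qed.

Lemma convex_set_segment (V : lmodType R) (X : set V) x y s :
  convex_set X -> X x -> X y -> 0 <= s <= 1 -> X (x + s *: (y - x)).
Proof.
move=> cX Xx Xy s01.
rewrite (_ : _ + _ = s *: y + (1 - s) *: x); first exact: convex_set_conv.
by rewrite scalerBl scale1r scalerBr addrCA.
Qed.

Lemma subr_shift (V : zmodType) (a b x : V) : (a - x) - (b - x) = a - b.
Proof. by rewrite opprB addrA subrK. Qed.

(** Vector-valued maps have no intermediate point. Instead, the set of the [s]
    with [`|phi s - phi 0| <= (C + e) * s] contains its supremum, by the estimate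
    to the left of it, and this supremum is [1], by the estimate to the right. *)
Lemma mean_value_le (W : normedModType R) (phi : R -> W) C :
  (forall s, 0 <= s <= 1 -> forall e, 0 < e -> exists2 d, 0 < d &
    forall s', 0 <= s' <= 1 -> `|s' - s| < d ->
      `|phi s' - phi s| <= (C + e) * `|s' - s|) ->
  `|phi 1 - phi 0| <= C.
Proof.
move=> phiC; apply/ler_addgt0Pr => e e0.
pose S := [set s | 0 <= s <= 1 /\ `|phi s - phi 0| <= (C + e) * s].
have step s s' : S s -> s <= s' <= 1 -> `|phi s' - phi s| <= (C + e) * (s' - s) -> S s'.
  move=> [/andP[s0 s1] Ss] /andP[ss' s'1] ps.
  split; first by rewrite (le_trans s0 ss').
  rewrite -(subrK (phi s) (phi s')) -addrA (le_trans (ler_normD _ _))//.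
  by rewrite -(subrK s s') mulrDr lerD// subrK.
have S0 : S 0 by split; rewrite ?lexx ?ler01// subrr normr0 mulr0.
have supS : has_sup S by split; [exists 0|exists 1 => s [/andP[]]].
pose c := sup S.
have c01 : 0 <= c <= 1.
  by rewrite ub_le_sup ?ge_sup//; [by exists 0|by move=> s [/andP[]]|case: supS].
have [d d0 phid] := phiC c c01 e e0.
have Sc : S c.
  have [s Ss sc] := sup_adherent d0 supS.
  have sc' : s <= c by apply: ub_le_sup Ss; case: supS.
  apply: (step s) => //; first by rewrite sc'; case/andP: c01.
  have [s01 _] := Ss; have := phid s s01.
  by rewrite distrC ger0_norm ?subr_ge0// distrC ltrBlDl -ltrBlDr; apply.
have [c1|c1] := ltP c 1; last first.
  have {}c1 : c = 1 by apply/eqP; rewrite eq_le c1; case/andP: c01 => _ ->.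
  by case: Sc => _; rewrite c1 mulr1.
pose m := Num.min 1 (c + d / 2).
have cm : c < m by rewrite lt_min c1 ltrDl divr_gt0.
suff /(ub_le_sup (proj2 supS)) : S m by rewrite leNgt cm.
have m1 : m <= 1 by rewrite ge_min lexx.
apply: (step c) => //; first by rewrite ltW.
have := phid m; rewrite ger0_norm ?subr_ge0 ?(ltW cm)//; apply.
  by rewrite m1 andbT (le_trans _ (ltW cm))//; case/andP: c01.
have : m <= c + d / 2 by rewrite ge_min lexx orbT.
by lra.
Qed.

Section Along.
Context {V W : normedModType R}.
Variables (X : set V) (convexX : convex_set X).
Implicit Types (f df : V -> W).

(** On the segment from [x] to [a] the derivative becomes a one-sided derivative
    in the real variable [s]; such segments exist even where [X] has no interior,
    and they suffice to test the size of a derivative and strong convexity. *)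
Lemma is_diff_within_along f df x a : is_diff_within X f df x -> X x -> X a ->
  forall e, 0 < e -> exists s0, 0 < s0 <= 1 /\ forall s, 0 < s <= s0 ->
    `|f (x + s *: (a - x)) - f x - s *: df (a - x)| <= e * s.
Proof.
move=> /is_diff_withinP[ldf _ fx] Xx Xa e e0.
have N0 : 0 < `|a - x| + 1 by rewrite ltr_pwDr.
have [d d0 fd] := fx _ (divr_gt0 e0 N0).
exists (Num.min 1 (d / (`|a - x| + 1) / 2)); split.
  by rewrite lt_min ltr01 !divr_gt0//= ge_min lexx.
move=> s /andP[s0]; rewrite le_min => /andP[s1 sd].
have Xs : X (x + s *: (a - x)) by apply: convex_set_segment => //; rewrite s1 ltW.
have sN : s * `|a - x| <= s * (`|a - x| + 1) by rewrite ler_wpM2l ?(ltW s0)// lerDl.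
have sNd : s * (`|a - x| + 1) <= d / 2 by rewrite -ler_pdivlMr// mulrAC.
have xs : x + s *: (a - x) - x = s *: (a - x) by rewrite addrAC subrr add0r.
have := fd _ Xs; rewrite xs normrZ gtr0_norm// (linear_funZ _ _ ldf).
have sd' : s * `|a - x| < d by lra.
move=> /(_ sd')/le_trans; apply.
rewrite mulrAC ler_pdivrMr// -mulrA ler_pM2l// ler_pM2l// lerDl.
Qed.

Lemma mean_value_within f (df : V -> V -> W) C x y :
  X x -> X y -> (forall z, X z -> is_diff_within X f (df z) z) ->
  (forall z, X z -> `|df z (y - x)| <= C) -> `|f y - f x| <= C.
Proof.
move=> Xx Xy fX dfC.
pose phi s := f (x + s *: (y - x)).
suff : `|phi 1 - phi 0| <= C by rewrite /phi scale1r scale0r addr0 (addrC x) subrK.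
apply: mean_value_le => s s01 e e0.
have Xs := convex_set_segment convexX Xx Xy.
have /is_diff_withinP[ldf _ fx] := fX _ (Xs _ s01).
have N0 : 0 < `|y - x| + 1 by rewrite ltr_pwDr.
have [d d0 fd] := fx _ (divr_gt0 e0 N0).
exists (d / (`|y - x| + 1)); first by rewrite divr_gt0.
move=> s' s'01; rewrite ltr_pdivlMr// => s'd.
have := fd _ (Xs _ s'01).
rewrite opprD addrACA subrr add0r -scalerBl normrZ (linear_funZ _ _ ldf).
have sN : `|s' - s| * `|y - x| <= `|s' - s| * (`|y - x| + 1) by rewrite ler_wpM2l// lerDl.
move=> /(_ (le_lt_trans sN s'd)) h.
rewrite -(subrK ((s' - s) *: df (x + s *: (y - x)) (y - x)) (_ - _)).
rewrite (le_trans (ler_normD _ _))// mulrDl addrC lerD//.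
  by rewrite normrZ mulrC ler_wpM2r// dfC//; exact: Xs.
rewrite (le_trans h)// mulrAC ler_pdivrMr// -mulrA.
by rewrite ler_pM2l.
Qed.

(** A Lipschitz constant of [f] bounds the derivative in the directions [a - b]
    although [x + s *: (a - b)] may leave [X]: moving from [x] towards [a] and
    towards [b] at the same speed stays in [X], and the two points reached differ
    by [s *: (a - b)]. *)
Lemma is_diff_within_lipschitz_dir f df (N : V -> R) M x a b :
  is_diff_within X f df x -> X x -> X a -> X b ->
  (forall s v, 0 <= s -> N (s *: v) = s * N v) ->
  (forall y z, X y -> X z -> `|f y - f z| <= M * N (y - z)) ->
  `|df (a - b)| <= M * N (a - b).
Proof.
move=> fx Xx Xa Xb NZ fM; apply/ler_addgt0Pr => e e0.
have e20 : 0 < e / 2 by rewrite divr_gt0.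
have [s1 [/andP[s10 s11] h1]] := is_diff_within_along fx Xx Xa e20.
have [s2 [/andP[s20 s21] h2]] := is_diff_within_along fx Xx Xb e20.
pose s := Num.min s1 s2.
have s0 : 0 < s by rewrite lt_min s10.
have Xs c : X c -> X (x + s *: (c - x)).
  by move=> Xc; apply: convex_set_segment => //; rewrite ltW//= ge_min s11.
have {}h1 : `|f (x + s *: (a - x)) - f x - s *: df (a - x)| <= e / 2 * s.
  by apply: h1; rewrite s0 ge_min lexx.
have {}h2 : `|f (x + s *: (b - x)) - f x - s *: df (b - x)| <= e / 2 * s.
  by apply: h2; rewrite s0 ge_min lexx orbT.
have := fM _ _ (Xs _ Xa) (Xs _ Xb).
set fa := f _ in h1 *; set fb := f _ in h2 *.
rewrite opprD addrACA subrr add0r -scalerBr subr_shift (NZ _ _ (ltW s0)) => hf.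
have [ldf _ _] := fx.
rewrite -(ler_pM2l s0).
have -> : s * `|df (a - b)| = `|s *: df (a - b)| by rewrite normrZ gtr0_norm.
have -> : s *: df (a - b) =
    (fa - fb) - (fa - f x - s *: df (a - x)) + (fb - f x - s *: df (b - x)).
  rewrite -(subr_shift a b x) (linear_funB _ _ ldf) scalerBr -(subr_shift fa fb (f x)).
  by rewrite [- (fa - f x - _)]opprB [_ - _ + (_ - (fa - f x))]addrC !subrKA.
rewrite (le_trans (ler_normD _ _))// mulrDr [s * e]mulrC.
have -> : e * s = e / 2 * s + e / 2 * s by field.
rewrite addrA lerD// (le_trans (ler_normB _ _))// lerD//.
by rewrite mulrCA.
Qed.

End Along.
End Convexity.

(** * Gradients of strongly convex functions *)

Section Gradients.
Context {R : realType}.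

(** The difference of two derivatives of [f] is a derivative of the zero map,
    which has Lipschitz constant [0]. Directions outside the span of [X - X] are
    not tested by [f], hence the restriction to [a - b]. *)
Lemma is_diff_within_unique_dir (V W : normedModType R) (X : set V)
    (f df df' : V -> W) x a b :
  convex_set X -> is_diff_within X f df x -> is_diff_within X f df' x ->
  X x -> X a -> X b -> df (a - b) = df' (a - b).
Proof.
move=> cX fx fx' Xx Xa Xb; apply/eqP; rewrite -subr_eq0 -normr_le0.
have : is_diff_within X (fun=> 0 : W) (fun h => df h - df' h) x.
  move/is_diff_withinP: fx => [ldf cdf fx]; move/is_diff_withinP: fx' => [ldf' cdf' fx'].
  apply/is_diff_withinP; split; first exact: linearBf.
    by move=> u; apply: cvgB; [exact: cdf|exact: cdf'].
  move=> e e0; have e20 : 0 < e / 2 by rewrite divr_gt0.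
  have [d d0 fd] := fx _ e20; have [d' d'0 fd'] := fx' _ e20.
  exists (Num.min d d') => [|y Xy]; first by rewrite lt_min d0.
  rewrite lt_min => /andP[yd yd'].
  rewrite subr0 sub0r opprB -(subrKA (f y - f x) (df' (y - x)) (- df (y - x))).
  rewrite (le_trans (ler_normD _ _))// [e]splitr mulrDl lerD ?fd//.
  by rewrite distrC fd'.
move=> /(@is_diff_within_lipschitz_dir _ _ _ X cX _ _ (fun v => `|v|) 0) h.
rewrite -(mul0r `|a - b|); apply: h => // [s v s0|y z _ _].
  by rewrite normrZ ger0_norm.
by rewrite subr0 normr0 mul0r.
Qed.

Lemma is_diff_within_grad n (X : set 'rV[R]_n) (F : 'rV[R]_n -> R) dF x :
  is_diff_within X (F : _ -> R^o) dF x ->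
  exists2 g, is_grad_within X F x g & forall h, dot g h = dF h.
Proof.
move=> Fx; have [ldF _ _] := Fx.
have dotE h : dot (\row_i dF 'e_i) h = dF h.
  pose f : {linear 'rV[R]_n -> R^o} :=
    HB.pack dF (GRing.isLinear.Build _ _ _ _ _ ldF).
  rewrite {2}(row_sum_delta h) -[dF]/(f : _ -> _) raddf_sum /dot.
  apply: eq_bigr => i _; rewrite mxE.
  by rewrite mulrC; exact/esym/(linear_funZ (h 0 i) 'e_i ldF).
exists (\row_i dF 'e_i) => //.
by rewrite /is_grad_within (_ : dot _ = dF)//; apply/funext.
Qed.

(** Divide the convexity inequality at [x + s *: (y - x)] by [s]: the left side
    tends to the directional derivative, and the quadratic term contributes
    [mu / 2 * (1 - s) * enorm (y - x) ^+ 2]. *)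
Lemma strongly_convex_grad_le n (X : set 'rV[R]_n) mu F x y g :
  strongly_convex X mu F -> convex_set X -> X x -> X y -> is_grad_within X F x g ->
  F x + dot g (y - x) + mu / 2 * enorm (y - x) ^+ 2 <= F y.
Proof.
move=> [mu0 cF] cX Xx Xy Fg; apply/ler_addgt0Pr => e e0.
have e20 : 0 < e / 2 by rewrite divr_gt0.
have [s0 [/andP[s00 s01]]] := is_diff_within_along cX Fg Xx Xy e20.
set N := enorm (y - x) ^+ 2; have N0 : 0 <= N by rewrite sqr_ge0.
have muN : 0 < mu * N + 1 by rewrite ltr_pwDr// mulr_ge0// ltW.
pose s := Num.min s0 (e / (mu * N + 1)).
have s_gt0 : 0 < s by rewrite lt_min s00 divr_gt0.
have s1 : s <= 1 by rewrite ge_min s01.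
(* [s] is also small enough for the lost part [mu / 2 * s * N] to stay below [e / 2]. *)
have sN : mu * N * s <= e.
  have : s * (mu * N + 1) <= e by rewrite -ler_pdivlMr// ge_min lexx orbT.
  by lra.
have /[swap]/(_ s) : s <= s0 by rewrite ge_min lexx.
rewrite s_gt0 /= => /[apply]; rewrite ler_norml => /andP[+ _].
have := cF (Itv01 (ltW s_gt0) s1) y x; rewrite !inE => /(_ Xy Xx).
set z := conv _ _ _; set w := conv _ _ _.
have -> : w = s * (F y - mu / 2 * enorm y ^+ 2) + (1 - s) * (F x - mu / 2 * enorm x ^+ 2) by [].
have -> : z = x + s *: (y - x).
  by rewrite [LHS](_ : _ = s *: y + (1 - s) *: x)// scalerBl scale1r scalerBr addrCA.
rewrite {}/w {}/z -[_ *: dot _ _]/(s * dot g (y - x)).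
have -> : enorm (x + s *: (y - x)) ^+ 2 =
    s * enorm y ^+ 2 + (1 - s) * enorm x ^+ 2 - s * (1 - s) * N.
  by rewrite /N !enorm_sqr !dotE (dotC y x); ring.
set Fz := F _; set d := dot g _ => h1 h2.
have : s * (F x + d + mu / 2 * N) <= s * (F y + e).
  rewrite -subr_ge0.
  apply: (@le_trans _ _ (s / 2 * (e - mu * N * s))).
    by rewrite mulr_ge0 ?divr_ge0 ?(ltW s_gt0)// subr_ge0.
  by lra.
by rewrite ler_pM2l.
Qed.

Lemma strongly_convex_grad_monotone n (X : set 'rV[R]_n) mu F x y gx gy :
  strongly_convex X mu F -> convex_set X -> X x -> X y ->
  is_grad_within X F x gx -> is_grad_within X F y gy ->
  mu * enorm (x - y) ^+ 2 <= dot (gx - gy) (x - y).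
Proof.
move=> sF cX Xx Xy Fx Fy.
have := strongly_convex_grad_le sF cX Xx Xy Fx.
have := strongly_convex_grad_le sF cX Xy Xx Fy.
rewrite [enorm (y - x)]enormBC dotBl -[y - x]opprB dotNr; lra.
Qed.

End Gradients.

(** * The projected gradient step *)

Section Projection.
Context {R : realType} {n : nat}.
Variable X : set 'rV[R]_n.
Hypotheses (convexX : convex_set X) (closedX : closed X)
  (boundedX : bounded_set X) (nonemptyX : X !=set0).
Implicit Types x y z : 'rV[R]_n.

Lemma enorm_dist_continuous y : continuous (fun z => enorm (y - z)).
Proof.
move=> z; apply/(@cvgrPdist_le _ _ _ (nbhs z)) => e e0; apply/nbhs_ballP.
exists (e / (Num.sqrt n%:R + 1)) => [|z']; first by rewrite /= divr_gt0// ltr_pwDr.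
rewrite -ball_normE /= ltr_pdivlMr ?ltr_pwDr// => zz'.
have zz : enorm (z - z') <= e.
  rewrite (le_trans (enorm_le_norm _))// mulrC (le_trans _ (ltW zz'))//.
  by rewrite ler_wpM2l// lerDl.
have := enorm_dist_le y z z'; have := enorm_dist_le y z' z.
rewrite (enormBC z' z) ler_distl; lra.
Qed.

Lemma euclidean_projP y : X (euclidean_proj X y) /\
  forall z, X z -> enorm (y - euclidean_proj X y) <= enorm (y - z).
Proof.
apply: (@getPex _ [set p | X p /\ forall z, X z -> enorm (y - p) <= enorm (y - z)]).
have [] := @EVT_min_rV R n (fun z => enorm (y - z)) X nonemptyX.
- exact: bounded_closed_compact.
- exact/continuous_subspaceT/enorm_dist_continuous.
- move=> p; rewrite inE => Xp pmin; exists p; split=> // z Xz.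
  by apply: pmin; rewrite inE.
Qed.

Lemma euclidean_proj_dot_le0 y z : X z ->
  dot (y - euclidean_proj X y) (z - euclidean_proj X y) <= 0.
Proof.
move=> Xz; have [] := euclidean_projP y; set p := euclidean_proj X y => Xp pmin.
rewrite leNgt; apply/negP; set c := dot _ _ => c0.
set N := dot (z - p) (z - p); have N0 : 0 <= N := dot_ge0 _.
have N1 : 0 < N + 1 by rewrite ltr_pwDr.
(* If [c] were positive, [p + s *: (z - p)] would be closer to [y] than [p]. *)
pose s := Num.min 1 (c / (N + 1)).
have s0 : 0 < s by rewrite lt_min ltr01 divr_gt0.
have s1 : s <= 1 by rewrite ge_min lexx.
have sN : s * (N + 1) <= c by rewrite -ler_pdivlMr// ge_min lexx orbT.
have := pmin _ (convex_set_segment convexX Xp Xz (introT andP (conj (ltW s0) s1))).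
rewrite -(@ler_pXn2r _ 2) ?nnegrE ?enorm_ge0// !enorm_sqr opprD addrA.
rewrite [X in _ <= X](_ : _ = dot (y - p) (y - p) - 2 * s * c + s * (s * N)); last first.
  rewrite /c /N; move: (y - p) (z - p) => v w.
  by rewrite !dotE (dotC w v); ring.
have : s * (s * (N + 1)) <= s * c by rewrite ler_pM2l.
have : 0 < s * c by rewrite mulr_gt0.
have : 0 < s * s by rewrite mulr_gt0.
lra.
Qed.

(** The multiples of differences of points of a convex set form a linear
    subspace: after exchanging end points the coefficients are nonnegative, and
    then both end points are averages with the same weights. *)
Lemma convex_dir_comb x1 x2 y1 y2 a b : X x1 -> X x2 -> X y1 -> X y2 ->
  exists c z1 z2, [/\ X z1, X z2 & a *: (x1 - x2) + b *: (y1 - y2) = c *: (z1 - z2)].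
Proof.
wlog a0 : a x1 x2 / 0 <= a.
  move=> H Xx1 Xx2 Xy1 Xy2; have [a0|a0] := leP 0 a; first exact: H.
  rewrite (_ : a *: (x1 - x2) = - a *: (x2 - x1)); last by rewrite -opprB scalerN scaleNr.
  by apply: H => //; rewrite oppr_ge0 ltW.
wlog b0 : b y1 y2 / 0 <= b.
  move=> H Xx1 Xx2 Xy1 Xy2; have [b0|b0] := leP 0 b; first exact: H.
  rewrite (_ : b *: (y1 - y2) = - b *: (y2 - y1)); last by rewrite -opprB scalerN scaleNr.
  by apply: H => //; rewrite oppr_ge0 ltW.
move=> Xx1 Xx2 Xy1 Xy2.
have [ab|ab] := eqVneq (a + b) 0.
  exists 0, x1, x1; split=> //; have [-> ->] : a = 0 /\ b = 0 by split; lra.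
  by rewrite !scale0r addr0.
have ab0 : 0 < a + b by rewrite lt_neqAle eq_sym ab addr_ge0.
pose s := a / (a + b).
have s01 : 0 <= s <= 1 by rewrite divr_ge0 ?addr_ge0//= ler_pdivrMr// mul1r lerDl.
exists (a + b), (s *: x1 + (1 - s) *: y1), (s *: x2 + (1 - s) *: y2).
split; [exact: convex_set_conv|exact: convex_set_conv|].
have as_ : (a + b) * s = a by rewrite /s mulrC divfK.
have bs_ : (a + b) * (1 - s) = b by rewrite mulrBr mulr1 as_; ring.
by rewrite opprD addrACA -!scalerBr [(a + b) *: _]scalerDr !scalerA as_ bs_.
Qed.

Lemma dot_dir_comb_le w C x1 x2 y1 y2 a b :
  (forall x y, X x -> X y -> `|dot w (x - y)| <= C * enorm (x - y)) ->
  X x1 -> X x2 -> X y1 -> X y2 ->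
  `|dot w (a *: (x1 - x2) + b *: (y1 - y2))| <=
    C * enorm (a *: (x1 - x2) + b *: (y1 - y2)).
Proof.
move=> wC Xx1 Xx2 Xy1 Xy2.
have [c [z1 [z2 [Xz1 Xz2 ->]]]] := convex_dir_comb a b Xx1 Xx2 Xy1 Xy2.
by rewrite dotZr normrM enormZ mulrCA ler_wpM2l// wC.
Qed.

(** The Cauchy-Schwarz inequality in the plane, for the unit vector along
    [(p, e)]. It is applied with [m = alpha * mu] and [l] the product of [alpha]
    and a Lipschitz constant, so [m ^+ 2 + l ^+ 2] is of second order in [alpha]
    and [(1 - m) ^+ 2 + l ^+ 2 <= 1 - m <= (1 - m / 2) ^+ 2]. *)
Lemma planar_rotation_le (m l p e d : R) : 0 <= m <= 1 -> 0 <= l ->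
  m ^+ 2 + l ^+ 2 <= m -> 0 <= p -> 0 <= e -> 0 <= d -> d ^+ 2 = p ^+ 2 + e ^+ 2 ->
  (1 - m) * p + l * e <= (1 - m / 2) * d.
Proof.
move=> /andP[m0 m1] l0 ml p0 e0 d0 dE.
have rhs0 : 0 <= (1 - m / 2) * d by rewrite mulr_ge0//; lra.
have lhs0 : 0 <= (1 - m) * p + l * e by rewrite addr_ge0 ?mulr_ge0// subr_ge0.
rewrite -(@ler_pXn2r _ 2)//.
rewrite [leRHS]exprMn dE.
have CS : ((1 - m) * p + l * e) ^+ 2 <= ((1 - m) ^+ 2 + l ^+ 2) * (p ^+ 2 + e ^+ 2).
  rewrite -subr_ge0 [X in 0 <= X](_ : _ = ((1 - m) * e - l * p) ^+ 2) ?sqr_ge0//.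
  by ring.
apply: (le_trans CS); rewrite ler_wpM2r ?addr_ge0 ?sqr_ge0//.
have := sqr_ge0 m; rewrite !expr2 in ml *; lra.
Qed.

(** Sum of the variational inequalities of the two projections. Firmness is used
    instead of mere nonexpansiveness because it pairs [y1 - y2] with a difference
    of points of [X] only, so that the components of gradients orthogonal to
    [X - X] disappear. *)
Lemma euclidean_proj_firm y1 y2 :
  enorm (euclidean_proj X y1 - euclidean_proj X y2) ^+ 2 <=
    dot (y1 - y2) (euclidean_proj X y1 - euclidean_proj X y2).
Proof.
have [Xp1 _] := euclidean_projP y1; have [Xp2 _] := euclidean_projP y2.
have := euclidean_proj_dot_le0 y1 Xp2; have := euclidean_proj_dot_le0 y2 Xp1.
move: (euclidean_proj X y1) (euclidean_proj X y2) => p1 p2.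
rewrite enorm_sqr -[p2 - p1]opprB dotNr.
move: (dotBl y1 p1 (p1 - p2)) (dotBl y2 p2 (p1 - p2)).
move: (dotBl p1 p2 (p1 - p2)) (dotBl y1 y2 (p1 - p2)) => -> -> -> ->.
lra.
Qed.

(** Core of the contraction of a gradient step: [w] is a difference of gradients
    at points that differ by [dx], known only against vectors of the span of
    [X - X], so [enorm (dx - alpha *: w)] cannot be bounded. Instead the test
    vector [v] is split into its component along [dx], where strong convexity
    acts, and an orthogonal component, where the Lipschitz bound is enough. *)
Lemma gradient_step_dot_le (alpha mu l : R) (dx v w : 'rV[R]_n) :
  0 < mu -> 0 <= l -> 0 < alpha -> alpha * mu <= 1 -> alpha * l <= 1 ->
  alpha * (mu ^+ 2 + l ^+ 2) <= mu ->
  mu * enorm dx ^+ 2 <= dot w dx <= l * enorm dx ^+ 2 ->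
  (forall a, `|dot w (v + a *: dx)| <= l * enorm dx * enorm (v + a *: dx)) ->
  dot dx v - alpha * dot w v <= (1 - alpha * mu / 2) * enorm dx * enorm v.
Proof.
move=> mu0 l0 al0 almu all alml /andP[wmu wl] wv.
pose a := dot dx v / enorm dx ^+ 2.
have adx : dot dx v = a * enorm dx ^+ 2.
  rewrite /a; have [/enorm_eq0 ->|dx0] := eqVneq (enorm dx) 0.
    by rewrite dotC dot0r !mul0r.
  by rewrite divfK// expf_neq0.
move: a adx => a adx.
have := wv (- a); have : v + - a *: dx = v - a *: dx by rewrite scaleNr.
move=> ->; move vE : (v - a *: dx) => e wE.
have {vE}vE : v = a *: dx + e by rewrite -vE addrC subrK.
have dxe : dot dx e = 0.
  move: adx; rewrite vE dotDr dotZr -enorm_sqr => /eqP.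
  by rewrite -subr_eq0 addrAC subrr add0r => /eqP.
have ve : enorm v ^+ 2 = (`|a| * enorm dx) ^+ 2 + enorm e ^+ 2.
  rewrite exprMn real_normK ?num_real// !enorm_sqr vE !dotE (dotC e dx) dxe.
  by ring.
have wvE : dot w v = a * dot w dx + dot w e by rewrite vE dotDr dotZr.
have rot : (1 - alpha * mu) * (`|a| * enorm dx) + alpha * l * enorm e <=
    (1 - alpha * mu / 2) * enorm v.
  apply: planar_rotation_le;
    rewrite ?almu ?enorm_ge0 ?mulr_ge0 ?enorm_ge0 ?(ltW al0) ?(ltW mu0) ?normr_ge0//.
  by rewrite !exprMn -mulrDr expr2 -mulrA ler_pM2l.
have h1 : a * (enorm dx ^+ 2 - alpha * dot w dx) <= `|a| * ((1 - alpha * mu) * enorm dx ^+ 2).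
  have dx2 := sqr_ge0 (enorm dx).
  have h : 0 <= enorm dx ^+ 2 - alpha * dot w dx.
    rewrite subr_ge0 (@le_trans _ _ (alpha * (l * enorm dx ^+ 2)))//.
      by rewrite ler_pM2l.
    by rewrite mulrA ler_piMl.
  rewrite (le_trans (ler_norm _))// normrM ler_wpM2l// ger0_norm//.
  by rewrite mulrBl mul1r lerB// -mulrA ler_pM2l.
have h2 : - (alpha * dot w e) <= enorm dx * (alpha * l * enorm e).
  have : - dot w e <= l * enorm dx * enorm e.
    by rewrite (le_trans _ wE)// -normrN ler_norm.
  by rewrite -(ler_pM2l al0); lra.
have h3 := ler_wpM2l (enorm_ge0 dx) rot.
rewrite wvE adx.
move: h1 h2 h3; rewrite expr2.
move: (enorm dx) (enorm v) (enorm e) (dot w dx) (dot w e) `|a| => *.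
by lra.
Qed.

(** The gradient [g] stands between [g1] and [g2]: it is taken at the first point
    for the second function, which separates the effect of moving the point from
    that of changing the function, measured by [d]. *)
Lemma projected_gradient_step_le (x1 x2 g1 g2 g : 'rV[R]_n) (mu l d alpha : R) :
  X x1 -> X x2 -> 0 < mu -> 0 <= l -> 0 <= d ->
  0 < alpha -> alpha * mu <= 1 -> alpha * l <= 1 ->
  alpha * (mu ^+ 2 + l ^+ 2) <= mu ->
  mu * enorm (x1 - x2) ^+ 2 <= dot (g - g2) (x1 - x2) ->
  (forall a b, X a -> X b ->
    `|dot (g - g2) (a - b)| <= l * enorm (x1 - x2) * enorm (a - b)) ->
  (forall a b, X a -> X b -> `|dot (g1 - g) (a - b)| <= d * enorm (a - b)) ->
  enorm (euclidean_proj X (x1 - alpha *: g1) - euclidean_proj X (x2 - alpha *: g2))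
    <= (1 - alpha * mu / 2) * enorm (x1 - x2) + alpha * d.
Proof.
move=> Xx1 Xx2 mu0 l0 d0 al0 almu all alml wmu wl vd.
have := euclidean_proj_firm (x1 - alpha *: g1) (x2 - alpha *: g2).
have [Xp1 _] := euclidean_projP (x1 - alpha *: g1).
have [Xp2 _] := euclidean_projP (x2 - alpha *: g2).
move: (euclidean_proj X (x1 - _)) (euclidean_proj X (x2 - _)) Xp1 Xp2 => p1 p2 Xp1 Xp2.
have -> : x1 - alpha *: g1 - (x2 - alpha *: g2) =
    x1 - x2 - alpha *: (g - g2) - alpha *: (g1 - g).
  by apply/rowP => i; rewrite !mxE; ring.
have core : dot (x1 - x2) (p1 - p2) - alpha * dot (g - g2) (p1 - p2) <=
    (1 - alpha * mu / 2) * enorm (x1 - x2) * enorm (p1 - p2).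
  apply: (@gradient_step_dot_le _ _ l) => //.
    rewrite wmu/= (le_trans (ler_norm _))// expr2 mulrA; exact: wl.
  move=> a; rewrite -[p1 - p2]scale1r; exact: dot_dir_comb_le.
have := vd _ _ Xp1 Xp2.
rewrite (dotBl _ (alpha *: (g1 - g))) (dotBl _ (alpha *: (g - g2))) !dotZl.
have D0 := enorm_ge0 (p1 - p2); have dx0 := enorm_ge0 (x1 - x2).
move: (dot (x1 - x2) (p1 - p2)) (dot (g - g2) (p1 - p2)) (dot (g1 - g) (p1 - p2)) core.
move: (enorm (p1 - p2)) (enorm (x1 - x2)) D0 dx0 => D dx D0 dx0 b c e core ed h.
have [->|Dn0] := eqVneq D 0.
  by rewrite addr_ge0 ?mulr_ge0 ?(ltW al0)//; lra.
have {Dn0}D_gt0 : 0 < D by rewrite lt_neqAle eq_sym Dn0.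
rewrite -(ler_pM2r D_gt0).
have : alpha * - e <= alpha * (d * D).
  by rewrite ler_pM2l// (le_trans _ ed)// -normrN ler_norm.
by rewrite expr2 in h; lra.
Qed.

End Projection.

(** * Completeness of the space of signals and fixed points *)

Section FixedPoint.
Context {R : realType}.

Lemma geometric_small (q C e : R) : 0 <= q < 1 -> 0 < e ->
  exists N, forall n, (N <= n)%N -> C * q ^+ n <= e.
Proof.
move=> /andP[q0 q1] e0.
have q1' : `|q| < 1 by rewrite ger0_norm.
have /cvgrPdist_le /(_ e e0) [N _ Nn] := cvg_geometric C q1'.
exists N => n /Nn /=; rewrite sub0r normrN /geometric /=.
by apply: le_trans; rewrite ler_norm.
Qed.

Lemma geometric_cauchy (V : normedZmodType R) (u : nat -> V) (q C : R) :
  0 <= q < 1 -> 0 <= C -> (forall k, `|u k.+1 - u k| <= C * q ^+ k) ->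
  forall m k, (k <= m)%N -> `|u m - u k| <= C / (1 - q) * q ^+ k.
Proof.
move=> /andP[q0 q1] C0 uq m k /subnK <-; move: (m - k)%N => j {m}.
have q1' : 0 < 1 - q by rewrite subr_gt0.
have CqE i : C / (1 - q) * q ^+ i = C * q ^+ i + C / (1 - q) * q ^+ i.+1.
  by rewrite exprS; field; rewrite gt_eqF.
have Cq0 i : 0 <= C / (1 - q) * q ^+ i.
  by rewrite mulr_ge0 ?exprn_ge0// divr_ge0// ltW.
elim: j k => [|j IH] k; first by rewrite add0n subrr normr0.
rewrite -(subrKA (u k.+1)) (le_trans (ler_normD _ _))// CqE addrC lerD//.
by rewrite addSnnS.
Qed.

Lemma uniform_limit_cvg (T : Type) (V : normedModType R) (F : set_system T)
    (f : T -> V) l : Filter F ->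
  (forall e, 0 < e -> exists (g : T -> V) (l' : V),
    [/\ forall s, `|f s - g s| <= e, `|l' - l| <= e & g @ F --> l']) ->
  f @ F --> l.
Proof.
move=> FF fg; apply/cvgrPdist_le => e e0.
have e30 : 0 < e / 3 by rewrite divr_gt0.
have [g [l' [fge l'l /cvgrPdist_le/(_ _ e30) gl]]] := fg _ e30.
apply: filterS gl => s gs.
rewrite -(subrKA l' l) (le_trans (ler_normD _ _))// -(subrKA (g s) l').
rewrite (le_trans (lerD (lexx _) (ler_normD _ _)))//.
by have := fge s; rewrite (distrC (f s)) (distrC l); lra.
Qed.

Section Complete.
Variable n : nat.

(** Pointwise limits exist in a finite-dimensional space; the Cauchy condition
    makes the convergence uniform, and uniform limits preserve both continuity
    and the limits at infinity. *)
Lemma C0_complete (u : nat -> C0 R n) :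
  (forall e, 0 < e -> exists N, forall m k, (N <= m)%N -> (N <= k)%N -> `|u m - u k| <= e) ->
  exists f : C0 R n, u @ \oo --> f.
Proof.
move=> cu.
have ut t : exists v : 'rV[R]_n, (fun k => u k t) @ \oo --> v.
  suff /cauchy_cvgP/cvg_ex : cauchy ((fun k => u k t) @ \oo) by [].
  apply: cauchy_exP => e e0; have [N uN] := cu _ (divr_gt0 e0 (ltr0n R 2)).
  exists (u N t); exists N => // k Nk; rewrite -ball_normE /=.
  rewrite (le_lt_trans (norm_le_enorm _))// (le_lt_trans (enorm_le_C0_norm (u N - u k) t))//.
  by rewrite (le_lt_trans (uN N k _ _))// ltr_pdivrMr// ltr_pMr// ltr1n.
have [f uf] := choice ut.
have fu e : 0 < e -> exists N, forall k, (N <= k)%N -> forall t, enorm (u k t - f t) <= e.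
  move=> e0; have [N uN] := cu _ e0; exists N => k Nk t; apply/ler_addgt0Pr => d d0.
  have d0' : 0 < d / (Num.sqrt n%:R + 1) by rewrite divr_gt0// ltr_pwDr.
  have /cvgrPdist_le/(_ _ d0')[M _ uM] := uf t.
  rewrite -(subrKA (u (maxn N M) t)) (le_trans (enormD _ _))// lerD//.
    apply: le_trans (enorm_le_C0_norm (u k - u (maxn N M)) t) _.
    by apply: uN => //; rewrite leq_maxl.
  rewrite enormBC (le_trans (enorm_le_norm _))//.
  have := uM (maxn N M) (leq_maxr _ _); rewrite /= ler_pdivlMr ?ltr_pwDr// mulrC.
  by apply: le_trans; rewrite ler_wpM2r// lerDl.
have fC : f \in is_C0.
  have lim (F : set_system R) (FF : Filter F) (l : 'rV[R]_n) (lk : nat -> 'rV[R]_n) :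
      (forall e, 0 < e -> exists N, forall k, (N <= k)%N -> `|lk k - l| <= e) ->
      (forall k, u k @ F --> lk k) -> f @ F --> l.
    move=> ll ul; apply: uniform_limit_cvg => e e0.
    have [N uN] := fu e e0; have [M lM] := ll e e0.
    exists (u (maxn N M)), (lk (maxn N M)); split=> //; last by rewrite lM ?leq_maxr.
    by move=> s; rewrite distrC (le_trans (norm_le_enorm _))// uN ?leq_maxl.
  have uC k := set_mem (C0_valP (u k)).
  apply/mem_set; split=> [t||].
  - apply: (@lim _ _ _ (fun k => u k t)) => [e e0|k].
      by have [N uN] := fu e e0; exists N => k Nk; rewrite (le_trans (norm_le_enorm _))// uN.
    by have [ck _ _] := uC k; exact: ck.
  - apply: (@lim _ _ _ (fun=> 0)) => [e e0|k]; last by have [] := uC k.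
    by exists 0%N => k _; rewrite subrr normr0 ltW.
  - apply: (@lim _ _ _ (fun=> 0)) => [e e0|k]; last by have [] := uC k.
    by exists 0%N => k _; rewrite subrr normr0 ltW.
exists (MkC0 fC); apply/cvgrPdist_le => e e0; have [N uN] := fu e e0.
exists N => // k Nk /=; rewrite distrC; apply: C0_norm_le => t.
exact: uN.
Qed.

End Complete.

Section SumNorm.
Variables nx nu : nat.
Implicit Types z : 'rV[R]_nx * C0 R nu.

Lemma sum_norm_ge0 z : 0 <= sum_norm z.
Proof. by rewrite addr_ge0 ?enorm_ge0. Qed.

Lemma sum_normD z1 z2 : sum_norm (z1 + z2) <= sum_norm z1 + sum_norm z2.
Proof. by rewrite /sum_norm addrACA lerD ?enormD ?ler_normD. Qed.

Lemma sum_normBC z1 z2 : sum_norm (z1 - z2) = sum_norm (z2 - z1).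
Proof. by rewrite /sum_norm enormBC distrC. Qed.

Lemma sum_norm_le_eq0 z : sum_norm z <= 0 -> z = 0.
Proof.
case: z => x u; rewrite /sum_norm /= => xu.
have x0 := enorm_ge0 x; have u0 := normr_ge0 u.
have /enorm_eq0-> : enorm x = 0 by lra.
by have /normr0_eq0-> : `|u| = 0 by lra.
Qed.

(** Banach's theorem, proved on the components because the contraction is stated
    for [sum_norm], which is not the norm of the product. *)
Lemma contraction_fixpoint (A : set ('rV[R]_nx * C0 R nu)) q
    (T : 'rV[R]_nx * C0 R nu -> 'rV[R]_nx * C0 R nu) :
  closed A -> A !=set0 -> (forall z, A z -> A (T z)) ->
  contraction_with (fun z1 z2 => sum_norm (z1 - z2)) q A T ->
  exists2 p, A p & forall z, A z -> (fun k => iter k T z) @ \oo --> p /\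
    forall k, sum_norm (iter k T z - p) <= q ^+ k * sum_norm (z - p).
Proof.
move=> clA [z0 Az0] TA [q0 q1 Tq].
have q01 : 0 <= q < 1 by rewrite q0.
have TkA k z : A z -> A (iter k T z) by move=> Az; elim: k => //= k /TA.
pose C := sum_norm (T z0 - z0); have Cge0 : 0 <= C := sum_norm_ge0 _.
have Tk k : sum_norm (iter k.+1 T z0 - iter k T z0) <= C * q ^+ k.
  elim: k => [|k IH]; first by rewrite expr0 mulr1.
  rewrite iterS (le_trans (Tq _ _ (TkA k.+1 _ Az0) (TkA k _ Az0)))//.
  by rewrite exprS mulrCA ler_wpM2l.
pose x k := (iter k T z0).1; pose u k := (iter k T z0).2.
have xk k : `|x k.+1 - x k| <= C * q ^+ k.
  apply: le_trans (Tk k); rewrite (le_trans (norm_le_enorm _))// lerDl//.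
have uk k : `|u k.+1 - u k| <= C * q ^+ k.
  by apply: le_trans (Tk k); rewrite lerDr enorm_ge0.
have xc := geometric_cauchy q01 Cge0 xk; have uc := geometric_cauchy q01 Cge0 uk.
have [xs xxs] : exists xs : 'rV[R]_nx, x @ \oo --> xs.
  suff /cauchy_cvgP/cvg_ex : cauchy (x @ \oo) by [].
  apply: cauchy_exP => e e0.
  have [N hN] := geometric_small (C / (1 - q)) q01 (divr_gt0 e0 (ltr0n R 2)).
  exists (x N); exists N => // k Nk; rewrite -ball_normE /= distrC.
  rewrite (le_lt_trans (xc _ _ Nk))// (le_lt_trans (hN N _))//.
  by rewrite ltr_pdivrMr// ltr_pMr// ltr1n.
have [us uus] : exists us : C0 R nu, u @ \oo --> us.
  apply: C0_complete => e e0.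
  have [N hN] := geometric_small (C / (1 - q)) q01 e0.
  exists N => m k Nm Nk; have [mk|/ltnW mk] := leqP m k.
    by rewrite distrC (le_trans (uc _ _ mk))// hN.
  by rewrite (le_trans (uc _ _ mk))// hN.
pose p := (xs, us).
have zp : (fun k => iter k T z0) @ \oo --> p.
  rewrite (_ : (fun k => iter k T z0) = fun k => (x k, u k)).
    exact: cvg_pair xxs uus.
  by apply/funext => k; rewrite -surjective_pairing.
have Ap : A p by apply: closed_cvg zp => //; apply: nearW => k; exact: TkA.
have small e : 0 < e -> exists N, forall k, (N <= k)%N -> sum_norm (iter k T z0 - p) <= e.
  move=> e0; have e20 : 0 < e / 2 by rewrite divr_gt0.
  have e30 : 0 < e / 2 / (Num.sqrt nx%:R + 1) by rewrite divr_gt0// ltr_pwDr.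
  have /cvgrPdist_le/(_ _ e30)[N _ xN] := xxs.
  have /cvgrPdist_le/(_ _ e20)[M _ uM] := uus.
  exists (maxn N M) => k; rewrite geq_max => /andP[Nk Mk].
  rewrite [e]splitr lerD//=; last by rewrite distrC; exact: uM.
  rewrite enormBC (le_trans (enorm_le_norm _))//.
  have := xN k Nk; rewrite /= ler_pdivlMr ?ltr_pwDr// mulrC.
  by apply: le_trans; rewrite ler_wpM2r// lerDl.
have {xxs uus zp} Tp : T p = p.
  apply/eqP; rewrite -subr_eq0; apply/eqP/sum_norm_le_eq0/ler_addgt0Pr => e e0.
  have [N hN] := small _ (divr_gt0 e0 (ltr0n R 2)).
  rewrite add0r -(subrKA (iter N.+1 T z0)) (le_trans (sum_normD _ _))// [e]splitr lerD ?hN//.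
  rewrite /= (le_trans (Tq _ _ Ap (TkA _ _ Az0)))// sum_normBC.
  by rewrite (le_trans _ (hN N _))// ler_piMl ?sum_norm_ge0// ltW.
move: p Ap Tp {small} => p Ap Tp; exists p => // z Az.
have rate k : sum_norm (iter k T z - p) <= q ^+ k * sum_norm (z - p).
  elim: k => [|k IH]; first by rewrite expr0 mul1r.
  have := Tq _ _ (TkA k _ Az) Ap; rewrite Tp /= => /le_trans; apply.
  by rewrite exprS -mulrA ler_wpM2l.
split=> //; apply/cvgrPdist_le => e e0.
have [N hN] := geometric_small (sum_norm (z - p)) q01 e0.
exists N => // k Nk /=; rewrite distrC (le_trans _ (hN k Nk))// mulrC.
apply: le_trans (rate k); rewrite prod_normE ge_max; apply/andP; split.
  by rewrite (le_trans (norm_le_enorm _))// lerDl.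
by rewrite lerDr enorm_ge0.
Qed.

End SumNorm.
End FixedPoint.

(** * Bounds on Lipschitz maps and iterates of the inner contraction *)

Section Bounds.
Context {R : realType}.

Lemma bounded_set_bound (V : normedModType R) (A : set V) :
  bounded_set A -> exists2 B, 0 <= B & forall v, A v -> `|v| <= B.
Proof.
move=> [B [_ AB]]; exists (Num.max B 0 + 1) => [|v Av].
  by rewrite addr_ge0// le_max lexx orbT.
by apply: AB => //; rewrite ltr_pwDr// le_max lexx.
Qed.

Lemma bounded_set_enorm_dist n (A : set 'rV[R]_n) :
  bounded_set A -> exists2 B, 0 <= B & forall x y, A x -> A y -> enorm (x - y) <= B.
Proof.
move=> /bounded_set_bound[B B0 AB]; exists (Num.sqrt n%:R * (B + B)).
  by rewrite mulr_ge0 ?addr_ge0.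
move=> x y Ax Ay; rewrite (le_trans (enorm_le_norm _))// ler_wpM2l//.
by rewrite (le_trans (ler_normB _ _))// lerD ?AB.
Qed.

Lemma lipschitz_enorm n m (A : set ('rV[R]_n * 'rV[R]_m))
    (G : 'rV[R]_n * 'rV[R]_m -> 'rV[R]_n * 'rV[R]_m) :
  [lipschitz G z | z in A] -> exists2 k, 0 <= k & forall z1 z2, A z1 -> A z2 ->
    enorm (G z1 - G z2).1 <= k * (enorm (z1 - z2).1 + enorm (z1 - z2).2) /\
    enorm (G z1 - G z2).2 <= k * (enorm (z1 - z2).1 + enorm (z1 - z2).2).
Proof.
move=> [k [_ Gk]]; pose K := Num.max k 0 + 1.
have K0 : 0 <= K by rewrite addr_ge0// le_max lexx orbT.
have {}Gk z1 z2 : A z1 -> A z2 -> `|G z1 - G z2| <= K * (enorm (z1 - z2).1 + enorm (z1 - z2).2).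
  move=> Az1 Az2; have kK : k < K by rewrite ltr_pwDr// le_max lexx.
  have := Gk K kK (z1, z2) (conj Az1 Az2).
  move=> /le_trans; apply; rewrite ler_wpM2l// prod_normE ge_max.
  by rewrite ler_wpDr ?enorm_ge0 ?norm_le_enorm// ler_wpDl ?enorm_ge0 ?norm_le_enorm.
exists ((Num.sqrt n%:R + Num.sqrt m%:R) * K); first by rewrite mulr_ge0// addr_ge0.
move=> z1 z2 Az1 Az2; have := Gk z1 z2 Az1 Az2.
rewrite prod_normE ge_max => /andP[G1 G2]; rewrite -mulrA.
split; rewrite (le_trans (enorm_le_norm _))// ler_pM// ?lerDl ?lerDr//.
Qed.

Lemma lipschitz_enorm_snd_bound n m (A : set ('rV[R]_n * 'rV[R]_m))
    (G : 'rV[R]_n * 'rV[R]_m -> 'rV[R]_n * 'rV[R]_m) k D E :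
  0 <= k -> 0 <= D -> 0 <= E -> A !=set0 ->
  (forall z1 z2, A z1 -> A z2 -> enorm (z1 - z2).1 <= D /\ enorm (z1 - z2).2 <= E) ->
  (forall z1 z2, A z1 -> A z2 ->
    enorm (G z1 - G z2).2 <= k * (enorm (z1 - z2).1 + enorm (z1 - z2).2)) ->
  exists2 b, 0 <= b & forall z, A z -> enorm (G z).2 <= b.
Proof.
move=> k0 D0 E0 [z0 Az0] ADE Gk; exists (k * (D + E) + enorm (G z0).2).
  by rewrite addr_ge0 ?enorm_ge0// mulr_ge0// addr_ge0.
move=> z Az; rewrite -(subrK (G z0).2 (G z).2) (le_trans (enormD _ _))// lerD//.
have [zD zE] := ADE z z0 Az Az0.
by rewrite (le_trans (Gk z z0 Az Az0))// ler_wpM2l// lerD.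
Qed.

Lemma eval_diff n m (D : set 'rV[R]_m) (f df : 'rV[R]_m -> C0 R n) x t :
  is_diff_within D f df x -> is_diff_within D (fun y => f y t) (fun h => df h t) x.
Proof.
move=> fx.
have lt : linear (fun u : C0 R n => u t) by [].
apply: (@is_diff_within_comp _ _ _ _ D setT f df (fun u => u t) (fun u => u t)) => //.
apply: is_diff_within_linear => //.
apply: (@bounded_linear_continuous _ _ _ _ 1) => // u.
by rewrite mul1r (le_trans (norm_le_enorm _))// enorm_le_C0_norm.
Qed.

End Bounds.

Section Iterates.
Context {R : realType} {nx nu : nat}.
Variables (X : set 'rV[R]_nx) (U : set (C0 R nu))
  (P : 'rV[R]_nx -> C0 R nu -> C0 R nu).
Hypotheses (P_maps : forall x u, X x -> U u -> U (P x u)) (q : R) (q01 : 0 <= q < 1)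
  (P_contraction : forall x u1 u2, X x -> U u1 -> U u2 ->
     `|P x u1 - P x u2| <= q * `|u1 - u2|).

Lemma iterP_maps n x u : X x -> U u -> U (iterP P n x u).
Proof. by move=> Xx Uu; elim: n => //= n; exact: P_maps. Qed.

Lemma iterP_contraction n x u1 u2 : X x -> U u1 -> U u2 ->
  `|iterP P n x u1 - iterP P n x u2| <= q ^+ n * `|u1 - u2|.
Proof.
move=> Xx Uu1 Uu2; have [q0 _] := andP q01.
elim: n => [|n IH]; first by rewrite mul1r.
rewrite (le_trans (P_contraction Xx (iterP_maps n Xx Uu1) (iterP_maps n Xx Uu2)))//.
by rewrite exprS -mulrA ler_wpM2l.
Qed.

(** Each further application of [P] multiplies the Lipschitz constant in [x] by
    [q] and adds [M]; the geometric series keeps it below [M / (1 - q)],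
    uniformly in [n]. *)
Lemma iterP_lipschitz M : 0 <= M ->
  (forall x1 x2 u, X x1 -> X x2 -> U u -> `|P x1 u - P x2 u| <= M * enorm (x1 - x2)) ->
  forall n x1 x2 u1 u2, X x1 -> X x2 -> U u1 -> U u2 ->
  `|iterP P n x1 u1 - iterP P n x2 u2| <=
     M / (1 - q) * enorm (x1 - x2) + q ^+ n * `|u1 - u2|.
Proof.
move=> M0 PM n x1 x2 u1 u2 Xx1 Xx2 Uu1 Uu2; have [q0 q1] := andP q01.
have q1' : 0 < 1 - q by rewrite subr_gt0.
apply: le_trans (ler_distD (iterP P n x2 u1) _ _) _.
apply: lerD; last exact: iterP_contraction.
elim: n => [|n IH].
  by rewrite subrr normr0 mulr_ge0 ?enorm_ge0// divr_ge0// ltW.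
rewrite /=; apply: le_trans (ler_distD (P x2 (iterP P n x1 u1)) _ _) _.
have -> : M / (1 - q) * enorm (x1 - x2) =
    M * enorm (x1 - x2) + q * (M / (1 - q) * enorm (x1 - x2)).
  by field; rewrite gt_eqF.
have Un x : X x -> U (iterP P n x u1) by move=> Xx; exact: iterP_maps.
apply: lerD; first exact/PM/Un.
apply: le_trans (P_contraction Xx2 (Un _ Xx1) (Un _ Xx2)) _.
by rewrite ler_wpM2l.
Qed.

(** A derivative that is Lipschitz on a bounded set is bounded there, so the mean
    value inequality applies. *)
Lemma diff_bounded_lipschitz (dP : 'rV[R]_nx -> C0 R nu -> 'rV[R]_nx -> C0 R nu) k :
  convex_set X -> bounded_set X -> bounded_set U -> X !=set0 -> U !=set0 ->
  (forall x u, X x -> U u -> is_diff_within X (P^~ u) (dP x u) x) ->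
  (forall x1 x2 u1 u2, X x1 -> X x2 -> U u1 -> U u2 ->
        diff_norm (fun h => dP x1 u1 h - dP x2 u2 h) <=
          k * sum_norm (x1 - x2, u1 - u2)) ->
  exists2 M, 0 <= M & forall x1 x2 u, X x1 -> X x2 -> U u ->
    `|P x1 u - P x2 u| <= M * enorm (x1 - x2).
Proof.
move=> cX /bounded_set_enorm_dist[B B0 XB] /bounded_set_bound[C C_ge0 UC].
move=> [x0 Xx0] [u0 Uu0] PdP dPk.
have ldP x u (Xx : X x) (Uu : U u) : linear (dP x u) by have [] := PdP x u Xx Uu.
have := linear_seminorm_le (ldP _ _ Xx0 Uu0) (@ler_normD _ _) (fun a v => normrZ a v).
set E := \sum_(i < nx) _ => dP0.
have E0 : 0 <= E by apply: sumr_ge0.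
pose M := `|k| * (B + (C + C)) + E.
have M0 : 0 <= M by rewrite addr_ge0// mulr_ge0// !addr_ge0.
exists M => // x1 x2 u Xx1 Xx2 Uu.
apply: (@mean_value_within _ _ _ X cX (P^~ u) (dP^~ u)) => //.
  by move=> x Xx; exact: PdP.
move=> x Xx; rewrite -(subrK (dP x0 u0 (x1 - x2)) (dP x u _)).
rewrite (le_trans (ler_normD _ _))// mulrDl lerD//.
rewrite (le_trans (norm_diff_le (linearBf (ldP _ _ Xx Uu) (ldP _ _ Xx0 Uu0)) _))//.
rewrite ler_wpM2r ?enorm_ge0// (le_trans (dPk _ _ _ _ Xx Xx0 Uu Uu0))//.
have s0 : 0 <= sum_norm (x - x0, u - u0) := sum_norm_ge0 _.
rewrite (le_trans (ler_wpM2r s0 (ler_norm k)))// ler_wpM2l// lerD ?XB//.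
by rewrite (le_trans (ler_normB _ _))// lerD ?UC.
Qed.

(** For negative [q] an odd power of [q] makes the right-hand side negative
    unless [U] is a single point, on which the term in [u] vanishes. *)
Lemma gradPn_bound_nonneg (r K : R) N
    (dPn : nat -> 'rV[R]_nx -> C0 R nu -> 'rV[R]_nx -> C0 R nu) :
  X !=set0 -> r < 1 ->
  (forall n x u, (N <= n)%N -> X x -> U u -> linear (dPn n x u)) ->
  (forall n x1 x2 u1 u2, (N <= n)%N -> X x1 -> X x2 -> U u1 -> U u2 ->
     diff_norm (fun h => dPn n x1 u1 h - dPn n x2 u2 h) <=
       r ^+ n * `|u1 - u2| + K * enorm (x1 - x2)) ->
  exists2 r', 0 <= r' < 1 &
  (forall n x1 x2 u1 u2, (N <= n)%N -> X x1 -> X x2 -> U u1 -> U u2 ->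
     diff_norm (fun h => dPn n x1 u1 h - dPn n x2 u2 h) <=
       r' ^+ n * `|u1 - u2| + K * enorm (x1 - x2)).
Proof.
move=> [x0 Xx0] r1 ldPn dPnr; have [r0|r0] := leP 0 r; first by exists r => //; rewrite r0.
exists 0; first by rewrite lexx ltr01.
have U1 u1 u2 : U u1 -> U u2 -> `|u1 - u2| = 0.
  move=> Uu1 Uu2; have Nn : (N <= N.*2.+1)%N by rewrite -addnn -addnS leq_addr.
  have := dPnr _ _ _ _ _ Nn Xx0 Xx0 Uu1 Uu2.
  have lB := linearBf (ldPn _ _ _ Nn Xx0 Uu1) (ldPn _ _ _ Nn Xx0 Uu2).
  rewrite subrr enorm0 mulr0 addr0 => /(le_trans (diff_norm_ge0 lB)).
  have rn : r ^+ N.*2.+1 < 0 by rewrite exprn_odd_lt0//= odd_double.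
  by rewrite nmulr_rge0// => h; apply/eqP; rewrite eq_le h normr_ge0.
move=> n x1 x2 u1 u2 Nn Xx1 Xx2 Uu1 Uu2.
rewrite (le_trans (dPnr _ _ _ _ _ Nn Xx1 Xx2 Uu1 Uu2))//.
by rewrite U1// !mulr0.
Qed.

End Iterates.

(** * Losses sampled at finitely many times *)

Section SampledLoss.
Context {R : realType} {nx nu Ns : nat}.
Variables (X : set 'rV[R]_nx) (B : set 'rV[R]_nu) (t : 'I_Ns -> R)
  (Li : 'I_Ns -> 'rV[R]_nx * 'rV[R]_nu -> R)
  (G : 'I_Ns -> 'rV[R]_nx * 'rV[R]_nu -> 'rV[R]_nx * 'rV[R]_nu).
Hypothesis Li_grad : forall i z, (X `*` B) z -> is_grad_within2 (X `*` B) (Li i) z (G i z).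

(** The [i]-th summand of the derivative of the loss at [x] in direction [h],
    when the signal [u] depends on [x] with derivative [df]. *)
Definition sample_diff (i : 'I_Ns) (x : 'rV[R]_nx) (u : C0 R nu)
    (df : 'rV[R]_nx -> C0 R nu) h :=
  dot (G i (x, u (t i))).1 h + dot (G i (x, u (t i))).2 (df h (t i)).

Lemma sampled_loss_grad (f df : 'rV[R]_nx -> C0 R nu) x :
  X x -> (forall y, X y -> forall s, B (f y s)) -> is_diff_within X f df x ->
  exists2 g, is_grad_within X (fun y => \sum_(i < Ns) Li i (y, f y (t i))) x g &
    forall h, dot g h = \sum_(i < Ns) sample_diff i x (f x) df h.
Proof.
move=> Xx fB fx; apply: is_diff_within_grad.
apply: (@is_diff_within_sum _ _ R^o) => i.
apply: (@is_diff_within_comp _ _ _ _ X (X `*` B) 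
  (fun y => (y, f y (t i))) (fun h => (h, df h (t i)))
  (Li i : _ -> R^o) (fun h => dot (G i (x, f x (t i))).1 h.1 + dot (G i (x, f x (t i))).2 h.2)).
- by move=> y Xy; split=> //=; exact: fB.
- apply: is_diff_within_pair; last exact: eval_diff.
  by apply: is_diff_within_linear => // y; exact: cvg_id.
- by apply: Li_grad; split=> //=; exact: fB.
Qed.

Section SampleDiffLipschitz.
Variables (k b : R) (i : 'I_Ns).
Hypotheses (k0 : 0 <= k) (Gk : forall z1 z2, (X `*` B) z1 -> (X `*` B) z2 ->
    enorm (G i z1 - G i z2).1 <= k * (enorm (z1 - z2).1 + enorm (z1 - z2).2) /\
    enorm (G i z1 - G i z2).2 <= k * (enorm (z1 - z2).1 + enorm (z1 - z2).2))
  (Gb : forall z, (X `*` B) z -> enorm (G i z).2 <= b).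

(** A difference of products is split so that the derivative of the signal is
    bounded ([M]) where the gradient of [Li] varies, and the gradient of [Li] is
    bounded ([b]) where the derivative of the signal varies. *)
Lemma sample_diff_lipschitz x1 x2 (u1 u2 : C0 R nu) df1 df2 (dx du d M : R) h :
  X x1 -> X x2 -> (forall s, B (u1 s)) -> (forall s, B (u2 s)) -> 0 <= M ->
  enorm (x1 - x2) <= dx -> `|u1 - u2| <= du ->
  `|df1 h - df2 h| <= d * enorm h -> `|df2 h| <= M * enorm h ->
  `|sample_diff i x1 u1 df1 h - sample_diff i x2 u2 df2 h| <=
    (k * (1 + M) * (dx + du) + b * d) * enorm h.
Proof.
move=> Xx1 Xx2 Bu1 Bu2 M0 hdx hdu hd hM.
have z1 : (X `*` B) (x1, u1 (t i)) by split=> /=.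
have z2 : (X `*` B) (x2, u2 (t i)) by split=> /=.
have [G1 G2] := Gk z1 z2; have Gb1 := Gb z1.
have dz : k * (enorm (x1 - x2) + enorm (u1 (t i) - u2 (t i))) <= k * (dx + du).
  by rewrite ler_wpM2l// lerD// (le_trans (enorm_le_C0_norm (u1 - u2) (t i))).
have {}G1 := le_trans G1 dz; have {}G2 := le_trans G2 dz.
have hd' : enorm (df1 h (t i) - df2 h (t i)) <= d * enorm h.
  by rewrite (le_trans (enorm_le_C0_norm (df1 h - df2 h) (t i))).
have hM' : enorm (df2 h (t i)) <= M * enorm h.
  by rewrite (le_trans (enorm_le_C0_norm (df2 h) (t i))).
rewrite /sample_diff.
move: (G i (x1, u1 (t i))) (G i (x2, u2 (t i))) G1 G2 Gb1 => [a1 b1] [a2 b2] /= G1 G2 Gb1.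
move: (df1 h (t i)) (df2 h (t i)) hd' hM' => v1 v2 hd' hM'.
have -> : dot a1 h + dot b1 v1 - (dot a2 h + dot b2 v2) =
    dot (a1 - a2) h + dot b1 (v1 - v2) + dot (b1 - b2) v2.
  by rewrite !dotBl dotBr; ring.
have c1 := le_trans (norm_dot_le (a1 - a2) h) (ler_wpM2r (enorm_ge0 h) G1).
have c2 := le_trans (norm_dot_le b1 (v1 - v2)) (ler_pM (enorm_ge0 _) (enorm_ge0 _) Gb1 hd').
have c3 := le_trans (norm_dot_le (b1 - b2) v2) (ler_pM (enorm_ge0 _) (enorm_ge0 _) G2 hM').
rewrite (le_trans (ler_normD _ _))// (le_trans (lerD (ler_normD _ _) (lexx _)))//.
move: c1 c2 c3; move: `|_| `|_| `|_| (enorm h) => r1 r2 r3 e c1 c2 c3.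
by lra.
Qed.

End SampleDiffLipschitz.
End SampledLoss.

(** * The gradient of the reduced loss *)

Section IteratedGradient.
Context {R : realType} {nx nu Ns : nat}.
Variables (X : set 'rV[R]_nx) (U : set (C0 R nu)) (B : set 'rV[R]_nu)
  (P : 'rV[R]_nx -> C0 R nu -> C0 R nu) (L : 'rV[R]_nx -> C0 R nu -> R)
  (t : 'I_Ns -> R) (Li : 'I_Ns -> 'rV[R]_nx * 'rV[R]_nu -> R)
  (G : 'I_Ns -> 'rV[R]_nx * 'rV[R]_nu -> 'rV[R]_nx * 'rV[R]_nu).
Hypotheses (convexX : convex_set X)
  (P_maps : forall x u, X x -> U u -> U (P x u))
  (UB : forall u s, U u -> B (u s))
  (L_form : forall x u, X x -> U u -> L x u = \sum_(i < Ns) Li i (x, u (t i)))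
  (Li_grad : forall i z, (X `*` B) z -> is_grad_within2 (X `*` B) (Li i) z (G i z)).

Lemma reducedL_grad n x u df : X x -> U u ->
  is_diff_within X (fun y => iterP P n y u) df x ->
  exists2 g, is_grad_within X (reducedL P L n u) x g &
    forall h, dot g h = \sum_(i < Ns) sample_diff t G i x (iterP P n x u) df h.
Proof.
move=> Xx Uu fx.
have Un y : X y -> U (iterP P n y u) by move=> Xy; exact: (iterP_maps P_maps).
have [|g Fg gE] := sampled_loss_grad t Li_grad Xx _ fx.
  by move=> y Xy s; exact/UB/Un.
exists g => //; apply: eq_is_diff_within Fg => // y Xy.
by rewrite /reducedL L_form//; exact: Un.
Qed.

Variables (k b : 'I_Ns -> R) (q r M K : R) (n : nat)
  (dPn : 'rV[R]_nx -> C0 R nu -> 'rV[R]_nx -> C0 R nu).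
Hypotheses (k0 : forall i, 0 <= k i) (b0 : forall i, 0 <= b i)
  (q01 : 0 <= q < 1) (r0 : 0 <= r) (M0 : 0 <= M)
  (Gk : forall i z1 z2, (X `*` B) z1 -> (X `*` B) z2 ->
    enorm (G i z1 - G i z2).1 <= k i * (enorm (z1 - z2).1 + enorm (z1 - z2).2) /\
    enorm (G i z1 - G i z2).2 <= k i * (enorm (z1 - z2).1 + enorm (z1 - z2).2))
  (Gb : forall i z, (X `*` B) z -> enorm (G i z).2 <= b i)
  (iterP_le : forall x1 x2 u1 u2, X x1 -> X x2 -> U u1 -> U u2 ->
    `|iterP P n x1 u1 - iterP P n x2 u2| <= M * enorm (x1 - x2) + q ^+ n * `|u1 - u2|)
  (dPnP : forall x u, X x -> U u -> is_diff_within X (fun y => iterP P n y u) (dPn x u) x)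
  (dPn_le : forall x1 x2 u1 u2, X x1 -> X x2 -> U u1 -> U u2 ->
    diff_norm (fun h => dPn x1 u1 h - dPn x2 u2 h) <=
      r ^+ n * `|u1 - u2| + K * enorm (x1 - x2)).

(** The two sums do not depend on [n]: the derivative of the iterate is bounded
    through the uniform Lipschitz constant [M] of the iterates, in the directions
    [a - c]. Hence the coefficient of [enorm (x1 - x2)] is uniform in [n], whereas
    that of the distance between the signals decays geometrically. *)
Lemma reducedL_grad_lipschitz x1 x2 u1 u2 g1 g2 a c :
  X x1 -> X x2 -> U u1 -> U u2 ->
  is_grad_within X (reducedL P L n u1) x1 g1 ->
  is_grad_within X (reducedL P L n u2) x2 g2 -> X a -> X c ->
  `|dot (g1 - g2) (a - c)| <=
    ((\sum_(i < Ns) (k i * (1 + M) * (1 + M) + b i * K)) * enorm (x1 - x2) +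
     (\sum_(i < Ns) (k i * (1 + M) + b i)) * (r ^+ n + q ^+ n) * `|u1 - u2|) * enorm (a - c).
Proof.
move=> Xx1 Xx2 Uu1 Uu2 Fg1 Fg2 Xa Xc.
have [g1' Fg1' g1E] := reducedL_grad Xx1 Uu1 (dPnP Xx1 Uu1).
have [g2' Fg2' g2E] := reducedL_grad Xx2 Uu2 (dPnP Xx2 Uu2).
rewrite dotBl (is_diff_within_unique_dir convexX Fg1 Fg1' Xx1 Xa Xc).
rewrite (is_diff_within_unique_dir convexX Fg2 Fg2' Xx2 Xa Xc) g1E g2E.
have df2 : `|dPn x2 u2 (a - c)| <= M * enorm (a - c).
  apply: (is_diff_within_lipschitz_dir (N := @enorm R nx) convexX (dPnP Xx2 Uu2)) => //.
    by move=> s v s0; rewrite enormZ ger0_norm.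
  move=> y z Xy Xz; have := iterP_le Xy Xz Uu2 Uu2.
  by rewrite (subrr u2) normr0 mulr0 addr0.
have ldP x u (Xx : X x) (Uu : U u) : linear (dPn x u) by have [] := dPnP Xx Uu.
have ddf : `|dPn x1 u1 (a - c) - dPn x2 u2 (a - c)| <=
    (r ^+ n * `|u1 - u2| + K * enorm (x1 - x2)) * enorm (a - c).
  apply: le_trans (norm_diff_le (linearBf (ldP _ _ Xx1 Uu1) (ldP _ _ Xx2 Uu2)) _) _.
  by rewrite ler_wpM2r ?enorm_ge0// dPn_le.
rewrite -sumrB (le_trans (ler_norm_sum _ _ _))//.
rewrite !mulr_suml -big_split mulr_suml; apply: ler_sum => i _ /=.
have Un x u : X x -> U u -> U (iterP P n x u) by move=> Xx Uu; exact: (iterP_maps P_maps).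
have sd := (sample_diff_lipschitz t (k0 i) (@Gk i) (@Gb i) Xx1 Xx2
  (fun s => UB s (Un _ _ Xx1 Uu1)) (fun s => UB s (Un _ _ Xx2 Uu2)) M0 (lexx _)
  (iterP_le Xx1 Xx2 Uu1 Uu2) ddf df2).
apply: le_trans sd _.
rewrite ler_wpM2r ?enorm_ge0//.
have h1 : 0 <= b i * q ^+ n * `|u1 - u2|.
  by rewrite !mulr_ge0// exprn_ge0//; case/andP: q01.
have h2 : 0 <= k i * (1 + M) * r ^+ n * `|u1 - u2|.
  by rewrite !mulr_ge0// ?addr_ge0// exprn_ge0.
move: h1 h2; move: (enorm _) `|_ - _| (q ^+ n) (r ^+ n) => d e f g h1 h2.
by lra.
Qed.

End IteratedGradient.

(** * Contraction of the coupled step *)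

Lemma closed_prod (S T : topologicalType) (A : set S) (B : set T) :
  closed A -> closed B -> closed (A `*` B).
Proof.
move=> clA clB; have -> : A `*` B = fst @^-1` A `&` snd @^-1` B by [].
by apply: closedI; apply: preimage_closed => // z _; [exact: cvg_fst|exact: cvg_snd].
Qed.

Section StepContraction.
Context {R : realType} {nx nu : nat}.
Variables (U : set (C0 R nu)) (X : set 'rV[R]_nx)
  (P : 'rV[R]_nx -> C0 R nu -> C0 R nu) (L : 'rV[R]_nx -> C0 R nu -> R).
Hypotheses (convexU : convex_set U) (convexX : convex_set X) (closedX : closed X)
  (boundedX : bounded_set X) (nonemptyX : X !=set0)
  (P_maps : forall x u, X x -> U u -> U (P x u)).

Lemma stepT_maps alpha sigma n z : 0 <= sigma <= 1 ->
  (X `*` U) z -> (X `*` U) (stepT P L X alpha sigma n z).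
Proof.
case: z => x u s01 [/= Xx Uu]; rewrite /stepT /=.
set y := x - _; have [Xp _] := euclidean_projP closedX boundedX nonemptyX y.
split=> //=; rewrite addrC.
by apply: convex_set_conv => //; exact: P_maps.
Qed.

Variables (q M mu l c : R) (n : nat).
Hypotheses (q01 : 0 <= q < 1) (M0 : 0 <= M) (mu0 : 0 < mu) (l0 : 0 <= l) (c0 : 0 <= c)
  (P_contraction : forall x u1 u2, X x -> U u1 -> U u2 ->
     `|P x u1 - P x u2| <= q * `|u1 - u2|)
  (P_lipschitz : forall x1 x2 u, X x1 -> X x2 -> U u ->
     `|P x1 u - P x2 u| <= M * enorm (x1 - x2))
  (grad_ex : forall x u, X x -> U u -> exists g, is_grad_within X (reducedL P L n u) x g)
  (grad_lip : forall x1 x2 u1 u2 g1 g2 a b, X x1 -> X x2 -> U u1 -> U u2 ->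
     is_grad_within X (reducedL P L n u1) x1 g1 ->
     is_grad_within X (reducedL P L n u2) x2 g2 -> X a -> X b ->
     `|dot (g1 - g2) (a - b)| <= (l * enorm (x1 - x2) + c * `|u1 - u2|) * enorm (a - b))
  (L_convex : forall u, U u -> strongly_convex X mu (reducedL P L n u)).

Lemma stepT_x_le alpha sigma x1 x2 u1 u2 :
  0 < alpha -> alpha * mu <= 1 -> alpha * l <= 1 ->
  alpha * (mu ^+ 2 + l ^+ 2) <= mu ->
  X x1 -> X x2 -> U u1 -> U u2 ->
  enorm ((stepT P L X alpha sigma n (x1, u1)).1 - (stepT P L X alpha sigma n (x2, u2)).1)
    <= (1 - alpha * mu / 2) * enorm (x1 - x2) + alpha * (c * `|u1 - u2|).
Proof.
move=> al0 almu all alml Xx1 Xx2 Uu1 Uu2; rewrite /stepT /=.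
have gradP x u (Xx : X x) (Uu : U u) :
    is_grad_within X (reducedL P L n u) x (grad_within X (reducedL P L n u) x).
  exact: (@getPex _ [set g | is_grad_within X _ x g]) (grad_ex Xx Uu).
have g1 := gradP x1 u1 Xx1 Uu1; have g2 := gradP x2 u2 Xx2 Uu2.
have g12 := gradP x1 u2 Xx1 Uu2.
apply: (projected_gradient_step_le convexX closedX boundedX nonemptyX
  (g := grad_within X (reducedL P L n u2) x1) (l := l)) => //.
- by rewrite mulr_ge0.
- exact: strongly_convex_grad_monotone (L_convex Uu2) convexX Xx1 Xx2 g12 g2.
- move=> a b Xa Xb; have := grad_lip Xx1 Xx2 Uu2 Uu2 g12 g2 Xa Xb.
  by rewrite (subrr u2) normr0 mulr0 addr0.
- move=> a b Xa Xb; have := grad_lip Xx1 Xx1 Uu1 Uu2 g1 g12 Xa Xb.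
  by rewrite (subrr x1) enorm0 mulr0 add0r.
Qed.

Lemma relaxation_le sigma p1 p2 u1 u2 : 0 <= sigma <= 1 ->
  X p1 -> X p2 -> U u1 -> U u2 ->
  `|((1 - sigma) *: u1 + sigma *: P p1 u1) - ((1 - sigma) *: u2 + sigma *: P p2 u2)|
    <= (1 - sigma * (1 - q)) * `|u1 - u2| + sigma * M * enorm (p1 - p2).
Proof.
move=> /andP[s0 s1] Xp1 Xp2 Uu1 Uu2.
have PP : `|P p1 u1 - P p2 u2| <= M * enorm (p1 - p2) + q * `|u1 - u2|.
  apply: le_trans (ler_distD (P p2 u1) _ _) _.
  by apply: lerD; [exact: P_lipschitz|exact: P_contraction].
rewrite opprD addrACA -!scalerBr; apply: le_trans (ler_normD _ _) _.
rewrite !normrZ (ger0_norm s0) ger0_norm ?subr_ge0//.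
move: (ler_wpM2l s0 PP); move: (enorm _) `|_ - _| `|_ - _| => d e f; lra.
Qed.

Lemma stepT_u_le alpha sigma x1 x2 u1 u2 : 0 <= sigma <= 1 ->
  X x1 -> X x2 -> U u1 -> U u2 ->
  `|(stepT P L X alpha sigma n (x1, u1)).2 - (stepT P L X alpha sigma n (x2, u2)).2|
    <= (1 - sigma * (1 - q)) * `|u1 - u2| + sigma * M *
    enorm ((stepT P L X alpha sigma n (x1, u1)).1 - (stepT P L X alpha sigma n (x2, u2)).1).
Proof.
move=> s01 Xx1 Xx2 Uu1 Uu2.
by apply: relaxation_le => //; exact: (euclidean_projP _ _ _ _).1.
Qed.

(** The new distance in [x] enters the sum norm directly and, multiplied by
    [sigma * M], through the relaxation. Half of the gains [alpha * mu / 2] in [x]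
    and [sigma * (1 - q)] in [u] pays for this and for the coupling [alpha * c],
    in which the factor [2] bounds [1 + sigma * M]. *)
Lemma stepT_contraction alpha sigma :
  0 < alpha -> alpha * mu <= 1 -> alpha * l <= 1 ->
  alpha * (mu ^+ 2 + l ^+ 2) <= mu -> 0 < sigma <= 1 ->
  sigma * M <= alpha * mu / 4 -> 2 * alpha * c <= sigma * (1 - q) / 2 ->
  contraction_with (fun z1 z2 => sum_norm (z1 - z2))
    (Num.max (1 - alpha * mu / 4) (1 - sigma * (1 - q) / 2)) (X `*` U)
    (stepT P L X alpha sigma n).
Proof.
move=> al0 almu all alml /andP[s0 s1] sM ac.
have [q0 q1] := andP q01.
have k0 : 0 < alpha * mu by rewrite mulr_gt0.
have sq : 0 < sigma * (1 - q) by rewrite mulr_gt0// subr_gt0.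
split.
- by rewrite le_max; apply/orP; left; lra.
- by rewrite gt_max; apply/andP; split; lra.
case=> x1 u1 [x2 u2] [/= Xx1 Uu1] [/= Xx2 Uu2].
have s01 : 0 <= sigma <= 1 by rewrite ltW.
have xle := @stepT_x_le alpha sigma _ _ _ _ al0 almu all alml Xx1 Xx2 Uu1 Uu2.
have ule := @stepT_u_le alpha sigma _ _ _ _ s01 Xx1 Xx2 Uu1 Uu2.
rewrite {1}/sum_norm.
have -> (z1 z2 : 'rV[R]_nx * C0 R nu) : (z1 - z2).1 = z1.1 - z2.1 by [].
have -> (z1 z2 : 'rV[R]_nx * C0 R nu) : (z1 - z2).2 = z1.2 - z2.2 by [].
move: xle ule.
move: (enorm ((stepT _ _ _ _ _ _ _).1 - _)) (`|(stepT _ _ _ _ _ _ _).2 - _|).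
rewrite /sum_norm /=; have := enorm_ge0 (x1 - x2); have := normr_ge0 (u1 - u2).
move: `|u1 - u2| (enorm (x1 - x2)) => du dx du0 dx0 xp up xle ule.
have sM0 : 0 <= sigma * M by rewrite mulr_ge0// ltW.
have h1 : (1 - alpha * mu / 4) * dx <=
    Num.max (1 - alpha * mu / 4) (1 - sigma * (1 - q) / 2) * dx.
  by rewrite ler_wpM2r// le_max lexx.
have h2 : (1 - sigma * (1 - q) / 2) * du <=
    Num.max (1 - alpha * mu / 4) (1 - sigma * (1 - q) / 2) * du.
  by rewrite ler_wpM2r// le_max lexx orbT.
rewrite mulrDr; apply: le_trans (lerD h1 h2).
apply: (le_trans (lerD (lexx _) ule)).
have : (1 + sigma * M) * xp <= (1 + sigma * M) * ((1 - alpha * mu / 2) * dx + alpha * (c * du)).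
  by rewrite ler_wpM2l// addr_ge0.
have : (1 + sigma * M) * ((1 - alpha * mu / 2) * dx) <= (1 - alpha * mu / 4) * dx.
  rewrite mulrA ler_wpM2r//.
  have : sigma * M * (1 - alpha * mu / 2) <= alpha * mu / 4 * 1.
    by rewrite ler_pM//; lra.
  by lra.
have : (1 + sigma * M) * (alpha * (c * du)) <= sigma * (1 - q) / 2 * du.
  rewrite !mulrA ler_wpM2r//; apply: le_trans ac.
  by rewrite ler_wpM2r// ler_wpM2r ?(ltW al0)//; lra.
by lra.
Qed.

End StepContraction.

(** The bounds on [alpha] are those that give the projected gradient step its gain
    [alpha * mu / 2]; [sigma] is small against [alpha], so that the change of [x]
    fed back into [u] costs at most half of that gain. *)
Lemma step_parameters {R : realType} (mu l M : R) :
  0 < mu -> 0 <= l -> 0 <= M -> exists alpha sigma : R,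
  [/\ 0 < alpha, alpha * mu <= 1, alpha * l <= 1 & alpha * (mu ^+ 2 + l ^+ 2) <= mu] /\
  (0 < sigma <= 1 /\ sigma * M <= alpha * mu / 4).
Proof.
move=> mu0 l0 M0; pose m := mu ^+ 2 + l ^+ 2 + mu * l + 1.
have mul0 : 0 <= mu * l by rewrite mulr_ge0// ltW.
have mu2 := sqr_ge0 mu; have l2 := sqr_ge0 l.
have m0 : 0 < m by rewrite ltr_pwDr// !addr_ge0.
have al0 : 0 < mu / m by rewrite divr_gt0.
have almu : mu / m * mu <= 1 by rewrite mulrAC ler_pdivrMr// mul1r -expr2 /m; lra.
have all : mu / m * l <= 1 by rewrite mulrAC ler_pdivrMr// mul1r /m; lra.
have alml : mu / m * (mu ^+ 2 + l ^+ 2) <= mu.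
  by rewrite mulrAC ler_pdivrMr// ler_pM2l// /m; lra.
move: (mu / m) al0 almu all alml => alpha al0 almu all alml.
have M1 : 0 < 4 * (M + 1) by rewrite mulr_gt0// ltr_pwDr.
exists alpha, (alpha * mu / (4 * (M + 1))); split=> //.
have s0 : 0 < alpha * mu / (4 * (M + 1)) by rewrite divr_gt0// mulr_gt0.
have : alpha * mu / (4 * (M + 1)) * (4 * (M + 1)) = alpha * mu by rewrite divfK// gt_eqF.
move: (alpha * mu / _) s0 => s s0; move: (alpha * mu) almu => e almu sE.
have sM : 0 <= s * M by rewrite mulr_ge0// ltW.
by rewrite s0; split; lra.
Qed.

(** * Convergence *)

Theorem theorem7 (R : realType) (nx nu Ns : nat)
    (U : set (C0 R nu)) (X : set 'rV[R]_nx)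
    (convexU : convex_set U) (closedU : closed U) (boundedU : bounded_set U)
    (nonemptyU : U !=set0)
    (convexX : convex_set X) (closedX : closed X) (boundedX : bounded_set X)
    (nonemptyX : X !=set0)
    (r : R) (rE : r = sup [set `|u| | u in U])
    (P : 'rV[R]_nx -> C0 R nu -> C0 R nu)
    (L : 'rV[R]_nx -> C0 R nu -> R)
    (t : 'I_Ns -> R) (Li : 'I_Ns -> 'rV[R]_nx * 'rV[R]_nu -> R)
    (P_maps : forall x u, X x -> U u -> U (P x u))
    (P_diff : forall x u, X x -> U u ->
      exists dP, is_diff_within X (P^~ u) dP x)
    (P_contraction : exists q, forall x, X x ->
      contraction_with (fun u1 u2 => `|u1 - u2|) q U (P x))
    (gradP_lipschitz : exists dP : 'rV[R]_nx -> C0 R nu -> 'rV[R]_nx -> C0 R nu,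
      (forall x u, X x -> U u -> is_diff_within X (P^~ u) (dP x u) x) /\
      exists k : R, forall x1 x2 u1 u2, X x1 -> X x2 -> U u1 -> U u2 ->
        diff_norm (fun h => dP x1 u1 h - dP x2 u2 h) <=
          k * sum_norm (x1 - x2, u1 - u2))
    (gradPn_bound : exists (q K : R) (N : nat)
        (dPn : nat -> 'rV[R]_nx -> C0 R nu -> 'rV[R]_nx -> C0 R nu),
      [/\ q < 1, 0 < K,
        forall n x u, (N <= n)%N -> X x -> U u ->
          is_diff_within X (fun y => iterP P n y u) (dPn n x u) x &
        forall n x1 x2 u1 u2, (N <= n)%N -> X x1 -> X x2 -> U u1 -> U u2 ->
          diff_norm (fun h => dPn n x1 u1 h - dPn n x2 u2 h) <=
            q ^+ n * `|u1 - u2| + K * enorm (x1 - x2)])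
    (L_form : forall x u, X x -> U u ->
      L x u = \sum_(i < Ns) Li i (x, u (t i)))
    (Li_C1 : forall i, exists G : 'rV[R]_nx * 'rV[R]_nu -> 'rV[R]_nx * 'rV[R]_nu,
      [/\ forall z, (X `*` euclidean_ball r) z ->
            is_grad_within2 (X `*` euclidean_ball r) (Li i) z (G z),
          {within X `*` euclidean_ball r, continuous G} &
          [lipschitz G z | z in X `*` euclidean_ball r]])
    (L_strongly_convex : exists mu : R, forall (u : C0 R nu) (n : nat), U u ->
      strongly_convex X mu (reducedL P L n u)) :
  exists (alpha sigma : R) (n : nat),
    [/\ 0 < alpha, 0 < sigma <= 1,
      (* the gradient used by the step exists *)
      forall x u, X x -> U u -> exists g, is_grad_within X (reducedL P L n u) x g,
      (forall z, (X `*` U) z -> (X `*` U) (stepT P L X alpha sigma n z)) /\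
      (exists q, contraction_with (fun z1 z2 => sum_norm (z1 - z2)) q (X `*` U)
        (stepT P L X alpha sigma n)) &
      exists (nu0 : R) (xs : 'rV[R]_nx) (us : C0 R nu),
        [/\ nu0 < 1, X xs, U us &
          forall x0 u0, X x0 -> U u0 ->
            ((fun k : nat => iter k (stepT P L X alpha sigma n) (x0, u0)) @ \oo
               --> (xs, us)) /\
            (forall k : nat,
              sum_norm (iter k (stepT P L X alpha sigma n) (x0, u0) - (xs, us))
                <= nu0 ^+ k * (enorm (x0 - xs) + `|u0 - us|))]].
Proof.
have [x0 Xx0] := nonemptyX; have [u0 Uu0] := nonemptyU.
have [q qP] := P_contraction; have [q0 q1 _] := qP x0 Xx0.
have q01 : 0 <= q < 1 by rewrite q0.
have {}qP x u1 u2 : X x -> U u1 -> U u2 -> `|P x u1 - P x u2| <= q * `|u1 - u2|.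
  by move=> Xx Uu1 Uu2; have [_ _ qx] := qP x Xx; exact: qx.
have [dP [dPP [k0 dPk]]] := gradP_lipschitz.
have [M M0 PM] := diff_bounded_lipschitz convexX boundedX boundedU nonemptyX nonemptyU dPP dPk.
have [p0 [K [N [dPn [p01 K0 dPnP dPn_le]]]]] := gradPn_bound.
have ldPn n x u : (N <= n)%N -> X x -> U u -> linear (dPn n x u).
  by move=> Nn Xx Uu; have [] := dPnP n x u Nn Xx Uu.
have [p /andP[p_ge0 p_lt1] {}dPn_le] := gradPn_bound_nonneg nonemptyX p01 ldPn dPn_le.
have UB u s : U u -> euclidean_ball r (u s).
  move=> Uu; rewrite /euclidean_ball /= (le_trans (enorm_le_C0_norm u s))// rE.
  have [C _ UC] := bounded_set_bound boundedU.
  by apply: ub_le_sup; [exists C => _ [v /UC vC <-]|exists u].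
have [G GP] := choice Li_C1.
have Ggrad i z : (X `*` euclidean_ball r) z ->
    is_grad_within2 (X `*` euclidean_ball r) (Li i) z (G i z).
  by have [Gi _ _] := GP i; exact: Gi.
have /choice[k kP] i : exists k, 0 <= k /\ forall z1 z2,
    (X `*` euclidean_ball r) z1 -> (X `*` euclidean_ball r) z2 ->
    enorm (G i z1 - G i z2).1 <= k * (enorm (z1 - z2).1 + enorm (z1 - z2).2) /\
    enorm (G i z1 - G i z2).2 <= k * (enorm (z1 - z2).1 + enorm (z1 - z2).2).
  by have [_ _ /lipschitz_enorm[k k_ge0 Gk]] := GP i; exists k.
have k_ge0 i : 0 <= k i by case: (kP i).
have [D D0 XD] := bounded_set_enorm_dist boundedX.
have Bu0 : euclidean_ball r (u0 0) by exact: UB.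
have r_ge0 : 0 <= r := le_trans (enorm_ge0 _) Bu0.
have /choice[b bP] i : exists b, 0 <= b /\ forall z, (X `*` euclidean_ball r) z -> enorm (G i z).2 <= b.
  have [||||z1 z2 [Xz1 Bz1] [Xz2 Bz2]|z1 z2 Az1 Az2|b b0 Gb] :=
    @lipschitz_enorm_snd_bound _ _ _ (X `*` euclidean_ball r) (G i) (k i) D (r + r).
  - exact: k_ge0.
  - exact: D0.
  - by rewrite addr_ge0.
  - by exists (x0, u0 0).
  - split; first exact: XD.
    by rewrite (le_trans (enormD _ _))// enormN lerD.
  - by have [_ /(_ z1 z2 Az1 Az2)[]] := kP i.
  - by exists b.
have b_ge0 i : 0 <= b i by case: (bP i).
have [mu muP] := L_strongly_convex; have [mu0 _] := muP u0 0%N Uu0.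
have M'0 : 0 <= M / (1 - q) by rewrite divr_ge0// subr_ge0 ltW.
have iterP_le := iterP_lipschitz P_maps q01 qP M0 PM.
have K_ge0 := ltW K0.
move M'E : (M / (1 - q)) M'0 iterP_le => M' M'0 iterP_le.
have M'1 : 0 <= 1 + M' by rewrite addr_ge0.
pose l := \sum_(i < Ns) (k i * (1 + M') * (1 + M') + b i * K).
pose c := \sum_(i < Ns) (k i * (1 + M') + b i).
have l0 : 0 <= l.
  by apply: sumr_ge0 => i _; rewrite addr_ge0// ?mulr_ge0// mulr_ge0.
have c0 : 0 <= c.
  by apply: sumr_ge0 => i _; rewrite addr_ge0// mulr_ge0.
have [alpha [sigma [[al0 almu all alml] [sigma01 sM]]]] := step_parameters mu0 l0 M0.
have [sigma0 sigma1] := andP sigma01.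
have e0 : 0 < sigma * (1 - q) / 4 by rewrite divr_gt0// mulr_gt0// subr_gt0.
have p01' : 0 <= p < 1 by rewrite p_ge0.
have [N1 hN1] := geometric_small (2 * alpha * c) p01' e0.
have [N2 hN2] := geometric_small (2 * alpha * c) q01 e0.
(* The number of inner iterations is chosen last, against both step sizes. *)
pose n := maxn N (maxn N1 N2).
have Nn : (N <= n)%N by rewrite leq_maxl.
have N1n : (N1 <= n)%N by rewrite /n maxnCA leq_maxl.
have N2n : (N2 <= n)%N by rewrite /n maxnA leq_maxr.
have cn0 : 0 <= c * (p ^+ n + q ^+ n) by rewrite mulr_ge0// addr_ge0 ?exprn_ge0.
have cn : 2 * alpha * (c * (p ^+ n + q ^+ n)) <= sigma * (1 - q) / 2.
  have := hN1 n N1n; have := hN2 n N2n.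
  by rewrite mulrA mulrDr => h2 h1; lra.
have gradE x u : X x -> U u -> exists g, is_grad_within X (reducedL P L n u) x g.
  move=> Xx Uu; have [g Fg _] := reducedL_grad P_maps UB L_form Ggrad Xx Uu (dPnP n x u Nn Xx Uu).
  by exists g.
have gradL x1 x2 u1 u2 g1 g2 a a' := @reducedL_grad_lipschitz _ _ _ _ X U _ P L t Li G
  convexX P_maps UB L_form Ggrad k b q p M' K n (dPn n) k_ge0 b_ge0 q01 p_ge0 M'0
  (fun i => (kP i).2) (fun i => (bP i).2) (iterP_le n) (fun x u => dPnP n x u Nn)
  (fun x1 x2 u1 u2 => dPn_le n x1 x2 u1 u2 Nn) x1 x2 u1 u2 g1 g2 a a'.
have s01 : 0 <= sigma <= 1 by rewrite ltW.
have Tmaps z : (X `*` U) z -> (X `*` U) (stepT P L X alpha sigma n z).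
  exact: stepT_maps.
have contr := stepT_contraction convexX closedX boundedX nonemptyX q01 M0 mu0 l0 cn0
  qP PM gradE gradL (fun u => muP u n) al0 almu all alml sigma01 sM cn.
exists alpha, sigma, n; split => //.
  by split=> //; eexists; exact: contr.
have A0 : X `*` U !=set0 by exists (x0, u0).
have [[xs us] [/= Xxs Uus] conv] :=
  contraction_fixpoint (closed_prod closedX closedU) A0 Tmaps contr.
have [_ Q1 _] := contr.
exists (Num.max (1 - alpha * mu / 4) (1 - sigma * (1 - q) / 2)), xs, us; split=> // x u Xx Uu.
exact: conv.
Qed.
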